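(* Let $K$ be a field of characteristic different from $2$ and $3$ containing a primitive third root of unity $\omega$. Let $a_1,a_2,a_3\in K$ and let $S\subset \mathbb{P}^3_K$ be the diagonal cubic surface with equation $$a_1(x_1^3 - x_4^3) + a_2(x_2^3 - x_4^3) + a_3(x_3^3 - x_4^3) = 0,$$ and assume that $S$ is smooth. Then there is a dominant rational map $\mathbb{P}^2_K \dashrightarrow S$, defined over $K$, of degree at most $6$.
   Context: A diagonal cubic surface over $K$ is a surface in $\mathbb{P}^3_K$ with an equation $\sum_{i=1}^4 b_i x_i^3 = 0$, $b_i\in K$. The degree of a dominant rational map between surfaces over $K$ is the degree of the corresponding extension of function fields. *)

(* Defs.v *)
From HB Require Import structures.
From mathcomp Require Import all_boot all_order all_algebra.
From mathcomp Require Export fraction mpoly.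

Set Implicit Arguments.
Unset Strict Implicit.
Unset Printing Implicit Defensive.

Import GRing.Theory.
Local Open Scope ring_scope.

Local Notation "x %:F" := (FracField.tofrac x) : ring_scope.

(* The coordinates x_1, ..., x_4 of P^3 are 'X_0, ..., 'X_3. *)
Definition diagonal_cubic (K : fieldType) (a1 a2 a3 : K) : {mpoly K[4]} :=
  a1 *: ('X_0 ^+ 3 - 'X_3 ^+ 3) + a2 *: ('X_1 ^+ 3 - 'X_3 ^+ 3)
  + a3 *: ('X_2 ^+ 3 - 'X_3 ^+ 3).

(* Smoothness over K of the hypersurface f = 0 in P^m (f homogeneous), by the
   Jacobian criterion. The singular points are sought over all extensions L of
   K, not only over K: the condition is geometric. *)
Definition smooth_hypersurface (K : fieldType) (m : nat)
    (f : {mpoly K[m.+1]}) : Prop :=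
  forall (L : fieldType) (iota : {rmorphism K -> L}) (x : 'I_m.+1 -> L),
    (map_mpoly iota f).@[x] = 0 ->
    (forall i, (map_mpoly iota f^`M(i)).@[x] = 0) ->
    forall i, x i = 0.

(* Below, a hypersurface V(f) is assumed integral (as every smooth cubic
   surface is), so that the homogeneous ideal of V(f) is the ideal (f). *)
Definition vanishes_on (K : fieldType) (m : nat)
    (f G : {mpoly K[m.+1]}) : Prop :=
  exists Q, G = Q * f.

(* F represents a rational map P^n --> V(f), y |-> (F_0(y) : ... : F_m(y)). *)
Definition is_rational_map (K : fieldType) (n m : nat) (f : {mpoly K[m.+1]})
    (F : (m.+1).-tuple {mpoly K[n.+1]}) : Prop :=
  [/\ exists d : nat, forall i, tnth F i \is d.-homog,
      exists i, tnth F i != 0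
    & f \mPo F = 0].

(* The image is (scheme-theoretically) dense: over a finite field K, density
   of the image on K-points would not be the right notion. *)
Definition dominant (K : fieldType) (n m : nat) (f : {mpoly K[m.+1]})
    (F : (m.+1).-tuple {mpoly K[n.+1]}) : Prop :=
  forall (d : nat) (G : {mpoly K[m.+1]}),
    G \is d.-homog -> G \mPo F = 0 -> vanishes_on f G.

(* K(P^n), as a subfield of K(y_0, ..., y_n). *)
Definition function_field_P (K : fieldType) (n : nat)
    (u : {fraction {mpoly K[n.+1]}}) : Prop :=
  exists (d : nat) (G H : {mpoly K[n.+1]}),
    [/\ G \is d.-homog, H \is d.-homog, H != 0 & u = G%:F / H%:F].

(* The image of the function field K(V(f)) in K(P^n) under pull-back along a
   dominant F. The elements of K(V(f)) are the G/H with G, H homogeneous of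
   the same degree and H not vanishing on V(f). *)
Definition pullback_function_field (K : fieldType) (n m : nat)
    (f : {mpoly K[m.+1]}) (F : (m.+1).-tuple {mpoly K[n.+1]})
    (u : {fraction {mpoly K[n.+1]}}) : Prop :=
  exists (d : nat) (G H : {mpoly K[m.+1]}),
    [/\ G \is d.-homog, H \is d.-homog, ~ vanishes_on f H
      & u = (G \mPo F)%:F / (H \mPo F)%:F].

(* [L : E] = k for subfields E, L of M with E contained in L. *)
Definition extension_degree (M : fieldType) (E L : M -> Prop) (k : nat) : Prop :=
  exists b : 'I_k -> M,
    [/\ forall i, L (b i),
        forall u, L u ->
          exists2 c : 'I_k -> M, (forall i, E (c i)) & u = \sum_i c i * b i
      & forall c : 'I_k -> M, (forall i, E (c i)) ->
          \sum_i c i * b i = 0 -> forall i, c i = 0].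

Definition has_degree (K : fieldType) (n m : nat) (f : {mpoly K[m.+1]})
    (F : (m.+1).-tuple {mpoly K[n.+1]}) (k : nat) : Prop :=
  extension_degree (pullback_function_field f F) (@function_field_P K n) k.

(* Main.v *)
Require Import Defs.
From HB Require Import structures.
From mathcomp Require Import all_boot all_order all_algebra all_field ring zify.
From Stdlib Require Import Classical ClassicalEpsilon.

Set Implicit Arguments.
Unset Strict Implicit.
Unset Printing Implicit Defensive.

Import GRing.Theory.
Local Open Scope ring_scope.

(* Let C be the section of S by its tangent plane at (1 : 1 : 1 : 1), with its
   parametrisation p by cubic forms coming from the directions of that plane. For
   a generic t, the directions u of the tangent plane of S at p(t) parametrise
   likewise the section of S by that plane, and the map is (t, u) |-> the residual
   point s of the line through p(t) with direction u. Given s, the parameter t is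
   a root of the polynomial \sum_i b_i p_i(t)^2 s_i of degree at most 6, and u is
   read off s and p(t), so K(P^2) is generated over K(S) by t alone.

   For dominance, start from the generic point s of S over K, adjoin a root t of
   that polynomial, and check that s is the image of the resulting point of P^2:
   the only obstruction is that the line through p(t) and s could lie on S, which
   by a Vandermonde argument forces s = p(t), impossible as C is a plane curve. *)

(** A line tangent to the surface at P meets it twice there, so its third intersection is rational
    in P and the direction; this makes both parametrisations explicit. The point (1 : 1 : 1 : 1) is
    on S because the four coefficients add up to 0. The constant 6 is 2 * 3: that s lies in the
    tangent plane at p(t) is quadratic in p(t), and p is cubic. It is only a bound, since that
    polynomial may be reducible.

    Dominance is obtained without dimension theory. A generic point is a tuple s over some extension
    of K at which only multiples of the equation f vanish; once s is, up to a factor, a value of the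
    map, every form killed by the map is a multiple of f. No count of points over K is involved, so
    finite fields need no separate treatment.

    All nondegeneracy is read off relations \sum_i m_i s_i^k = 0 with m_i in K. For degree reasons
    such a relation is trivial for k = 1 and proportional to f for k = 3. *)

Local Notation "x %:F" := (FracField.tofrac x) : ring_scope.

(** * Polynomials and their fractions *)

Lemma exists_irreducible_factor (F : fieldType) (p : {poly F}) :
  (1 < size p)%N -> exists2 q, irreducible_poly q & q %| p.
Proof.
have [n] := ubnP (size p); elim: n p => // n IHn p.
rewrite ltnS => le_p_n p_gt1.
have [irr_p | red_p] := classic (irreducible_poly p); first by exists p.
have [q [q_neq1 q_dv q_neqp]] : exists q : {poly F},
    [/\ size q != 1, q %| p & ~~ (q %= p)].
  apply: NNPP => no_q; apply: red_p; split=> // q q_neq1 q_dv.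
  by apply/negPn/negP => q_neqp; apply: no_q; exists q.
have p_neq0 : p != 0 by rewrite -size_poly_gt0 ltnW.
have q_neq0 := dvdpN0 q_dv p_neq0.
have lt_qp : (size q < size p)%N.
  by rewrite ltn_neqAle (dvdp_leq p_neq0 q_dv) andbT dvdp_size_eqp.
have [||r irr_r r_dv] := IHn q; first exact: leq_trans lt_qp le_p_n.
  by rewrite ltn_neqAle eq_sym q_neq1 size_poly_gt0.
by exists r => //; apply: dvdp_trans q_dv.
Qed.

Lemma exists_root_in_extension (F : fieldType) (p : {poly F}) :
  (1 < size p)%N ->
  exists (L : fieldType) (iota : {rmorphism F -> L}) (z : L),
    root (map_poly iota p) z.
Proof.
case/exists_irreducible_factor=> q irr_q q_dv.
have [L _ [z rt_z _]] := irredp_FAdjoin irr_q.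
exists L, (in_alg L), z; apply: (root_dvdp _ rt_z).
by rewrite dvdp_map.
Qed.

(** With [mmap_ext], this reduces the comparison of two ring morphisms out of a polynomial ring to
    constants and variables. *)
Lemma rmorph_mpolyE (K : comNzRingType) (n : nat) (S : comNzRingType)
    (phi : {rmorphism {mpoly K[n]} -> S}) p :
  phi p = mmap (phi \o @mpolyC n K) (fun i => phi 'X_i) p.
Proof.
rewrite {1}[p]mpolyE raddf_sum; apply: eq_bigr => m _ /=.
rewrite -mul_mpolyC rmorphM mpolyXE_id rmorph_prod /=; congr (_ * _).
by apply: eq_bigr => i _; rewrite rmorphXn.
Qed.

Lemma mmap_ext (K S : comNzRingType) (n : nat) (f f' : K -> S)
  (h h' : 'I_n -> S) : f =1 f' -> h =1 h' -> mmap f h =1 mmap f' h'.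
Proof.
move=> eqf eqh p; apply: eq_bigr => m _; rewrite eqf; congr (_ * _).
exact: mmap1_eq.
Qed.

Lemma mmap_comp_mpoly (K S : comNzRingType) (n k : nat)
    (iota : {rmorphism K -> S}) (y : 'I_k -> S)
    (F : n.-tuple {mpoly K[k]}) (G : {mpoly K[n]}) :
  mmap iota y (G \mPo F) = mmap iota (fun i => mmap iota y (tnth F i)) G.
Proof.
pose phi : {rmorphism {mpoly K[n]} -> S} := mmap iota y \o comp_mpoly F.
rewrite -[LHS]/(phi G) rmorph_mpolyE; apply: mmap_ext => [c | i] /=.
  by rewrite comp_mpolyC mmapC.
by rewrite comp_mpolyXU -tnth_nth.
Qed.

Lemma tofrac_inj (R : idomainType) : injective (@FracField.tofrac R).
Proof. by move=> x y /eqP; rewrite tofrac_eq => /eqP. Qed.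

Lemma fractionE (R : idomainType) (x : {fraction R}) :
  exists2 ab : R * R, ab.2 != 0 & x = ab.1%:F / ab.2%:F.
Proof.
suff [r xr] : exists r : {ratio R}, x * (r.2)%:F = (r.1)%:F.
  by exists r => /=; rewrite ?denom_ratioP // -xr mulfK // tofrac_eq0 denom_ratioP.
elim/quotW: x => r; exists r; unlock FracField.tofrac.
rewrite -[LHS]FracField.pi_mul; apply/eqmodP.
rewrite /= FracField.equivfE /FracField.mulf /=.
rewrite !numden_Ratio ?mulf_neq0 ?oner_eq0 ?denom_ratioP //.
by rewrite !mulr1 mulrC.
Qed.

Lemma muni_inj (K : comNzRingType) (n : nat) : injective (@muni n K).
Proof.
pose psi : {rmorphism {poly {mpoly K[n]}} -> {mpoly K[n.+1]}} :=
  horner_eval 'X_(@ord_max n) \o map_poly (@mwiden n K).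
apply: (can_inj (g := psi)) => p.
rewrite muniE [RHS]mpolyE rmorph_sum; apply: eq_bigr => m _ /=.
rewrite /horner_eval map_polyZ map_polyXn hornerZ hornerXn.
rewrite -mul_mpolyC rmorphM /= mwidenC mwidenX -mulrA mul_mpolyC; congr (_ *: _).
rewrite mpolyXn -mpolyXD; congr 'X_[_]; apply/mnmP => i.
rewrite mnmDE mulmnE mnm1E; case: (unliftP ord_max i) => [j ->|->].
  rewrite (negPf (neq_lift _ _)) mul0n addn0.
  have -> : lift ord_max j = widen_ord (leqnSn n) j.
    by apply: val_inj; rewrite /= /bump leqNgt ltn_ord.
  by rewrite mnmwiden_widen mnmE.
by rewrite mnmwiden_ordmax eqxx mul1n.
Qed.

(** Write c = e * gcd(c, p). As c is squarefree, e is coprime to the gcd, hence to p; but e divides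
    [p ^+ n], so it is a unit. *)
Lemma separable_dvdp_exp (k : fieldType) (c p : {poly k}) n :
  separable_poly c -> c %| p ^+ n -> c %| p.
Proof.
move=> sep_c c_dv; have /separable_polyP[sqf_c _] := sep_c.
have /dvdpP[e ce] := dvdp_gcdl c p.
have cop_ed : coprimep e (gcdp c p) by apply: sqf_c; rewrite -ce.
have cop_ep : coprimep e p.
  apply/coprimepP => d d_e d_p; move/coprimepP: cop_ed; apply=> //.
  by rewrite dvdp_gcd d_p ce dvdp_mulr.
have e_dv : e %| p ^+ n by apply: dvdp_trans c_dv; rewrite ce dvdp_mulr.
have /eqp_dvdl : c %= gcdp c p.
  rewrite {1}ce -{2}[gcdp c p]mul1r eqp_mul2r; last first.
    by rewrite gcdp_eq0 negb_and separable_poly_neq0.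
  by move/coprimepP: (coprimep_expr n cop_ep); apply.
by move->; apply: dvdp_gcdr.
Qed.

(** Infinite descent: [c] divides [p], then [q], and cancelling [c ^+ 3] leaves the same equation
    between the quotients, with a smaller [q]. *)
Lemma separable_not_cube (k : fieldType) (c p q : {poly k}) :
  (1 < size c)%N -> separable_poly c -> p ^+ 3 = c * q ^+ 3 -> q = 0.
Proof.
move=> c_gt1 sep_c; have [n] := ubnP (size q); elim: n p q => // n IHn p q.
rewrite ltnS => le_q_n pq; apply/eqP/negPn/negP => q_neq0.
have c_neq0 : c != 0 by rewrite -size_poly_gt0 ltnW.
have /dvdpP[p1 Dp] : c %| p.
  by apply: (@separable_dvdp_exp _ _ _ 3) => //; rewrite pq dvdp_mulr.
have q3 : q ^+ 3 = c * (c * p1 ^+ 3).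
  by apply: (mulfI c_neq0); rewrite -pq Dp; ring.
have /dvdpP[q1 Dq] : c %| q.
  by apply: (@separable_dvdp_exp _ _ _ 3) => //; rewrite q3 dvdp_mulr.
have q1_neq0 : q1 != 0 by apply: contraNneq q_neq0 => q10; rewrite Dq q10 mul0r.
have p1E : p1 ^+ 3 = c * q1 ^+ 3.
  by apply: (mulfI c_neq0); apply: (mulfI c_neq0); rewrite -q3 Dq; ring.
case/eqP: (q1_neq0); apply: (IHn p1) => //; apply: leq_trans le_q_n.
rewrite Dq size_mul //; case: (size c) c_gt1 => [|[|m]] // _.
by rewrite !addnS /= ltnS leq_addr.
Qed.

Lemma mcoeff_power_sum (K : nzRingType) (n k : nat) (g : 'I_n -> K) j :
  (0 < k)%N -> (\sum_i g i *: 'X_i ^+ k)@_(U_(j) *+ k)%MM = g j.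
Proof.
move=> k_gt0; rewrite raddf_sum (bigD1 j) //= big1 => [|i neq_ij].
  by rewrite mcoeffZ mpolyXn mcoeffX eqxx mulr1 addr0.
rewrite mcoeffZ mpolyXn mcoeffX (_ : _ == _ = false) ?mulr0 //.
apply/negbTE/eqP => /mnmP/(_ j); rewrite !mulmnE !mnm1E (negPf neq_ij) eqxx.
by case: k k_gt0.
Qed.

Lemma size_cubic_binomial (k : fieldType) (a e : k) :
  a != 0 -> size (a *: 'X^3 + e%:P) = 4%N.
Proof.
move=> a_neq0; have sz_a : size (a *: 'X^3) = 4%N by rewrite size_scale ?size_polyXn.
by rewrite size_polyDl ?sz_a // size_polyC; case: (_ == _).
Qed.

Lemma separable_cubic_binomial (k : fieldType) (a e : k) :
  3%:R != 0 :> k -> a != 0 -> e != 0 -> separable_poly (a *: 'X^3 + e%:P).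
Proof.
move=> three_neq0 a_neq0 e_neq0.
(* Euler's relation 3 r - X r' = 3 e for the binomial r, divided by 3 e. *)
rewrite unlock; apply/Bezout_eq1_coprimepP; exists (e^-1%:P, (- (3%:R * e)^-1)%:P * 'X) => /=.
rewrite derivD derivC derivZ derivXn addr0.
rewrite -!mul_polyC polyCN.
have -> : (3%:R * e)^-1%:P = 3%:R^-1%:P * e^-1%:P :> {poly k}.
  by rewrite -polyCM invfM.
have h3 : 3%:R * 3%:R^-1%:P = 1 :> {poly k}.
  by rewrite -polyC1 -polyCMn -polyCM divff.
have he : e%:P * e^-1%:P = 1 :> {poly k} by rewrite -polyCM divff.
have -> : 'X^2 *+ 3 = 3%:R * 'X^2 :> {poly k} by rewrite mulr_natl.
transitivity (e%:P * e^-1%:P + e^-1%:P * a%:P * 'X^3 * (1 - 3%:R * 3%:R^-1%:P)).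
  by ring.
by rewrite he h3 subrr mulr0 addr0.
Qed.

Lemma cubic_binomial_not_cube (R : nzRingType) (k : fieldType)
    (phi : {rmorphism R -> {poly k}}) (a e : k) (c p q : R) :
  injective phi -> 3%:R != 0 :> k -> a != 0 -> e != 0 ->
  phi c = a *: 'X^3 + e%:P -> p ^+ 3 = c * q ^+ 3 -> q = 0.
Proof.
move=> phi_inj three_neq0 a_neq0 e_neq0 phic pq; apply: phi_inj; rewrite rmorph0.
apply: (@separable_not_cube _ (a *: 'X^3 + e%:P) (phi p)).
- by rewrite size_cubic_binomial.
- exact: separable_cubic_binomial.
- by rewrite -phic -rmorphXn pq rmorphM rmorphXn.
Qed.

(** As a polynomial in the last variable, over the fractions in the other two, the form is a cubic
    binomial with nonzero constant term. It is then separable, and its product with a nonzero cube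
    is not a cube. *)
Lemma fermat_cubic_not_cube (K : fieldType) (g : 'I_3 -> K)
    (x : {fraction {mpoly K[3]}}) :
  3%N \notin [pchar K] -> (forall i, g i != 0) ->
  x ^+ 3 != (\sum_i g i *: 'X_i ^+ 3)%:F.
Proof.
move=> char3 g_neq0; have [[p q] /= q_neq0 ->] := fractionE x.
apply/eqP; rewrite expr_div_n => /(canRL (mulfVK _)) pq.
have {}pq : p ^+ 3 = (\sum_i g i *: 'X_i ^+ 3) * q ^+ 3.
  apply/eqP; rewrite -tofrac_eq rmorphXn rmorphM rmorphXn; apply/eqP/pq.
  by rewrite expf_neq0 // tofrac_eq0.
pose F2 := {fraction {mpoly K[2]}}.
pose phi : {rmorphism {mpoly K[3]} -> {poly F2}} :=
  map_poly (@FracField.tofrac {mpoly K[2]}) \o @muni 2 K.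
have phi_inj : injective phi.
  apply: inj_comp (@muni_inj _ _); apply: map_inj_poly (@tofrac_inj _) _; exact: rmorph0.
pose lift2 : 'I_2 -> 'I_3 := widen_ord (leqnSn 2).
have phiX j : phi 'X_(lift2 j) = (('X_j)%:F)%:P.
  rewrite /= muniE msuppX big_seq1 mcoeffX eqxx scale1r mnm1E.
  rewrite (_ : _ == _ = false) ?expr0; last by rewrite -val_eqE /= ltn_eqF.
  rewrite alg_polyC map_polyC /=; congr (('X_[_])%:F)%:P.
  by apply/mnmP => i; rewrite mnmE !mnm1E.
have phiXmax : phi 'X_ord_max = 'X.
  rewrite /= muniE msuppX big_seq1 mcoeffX eqxx scale1r mnm1E eqxx expr1.
  rewrite (_ : [multinom _ | _ < _] = 0%MM) ?mpolyX0 ?scale1r ?map_polyX //.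
  by apply/mnmP => i; rewrite mnmE mnm1E mnm0E -val_eqE /= gtn_eqF.
have phiC a : phi a%:MP = ((a%:MP)%:F)%:P by rewrite /= muniC map_polyC.
pose e : F2 := (\sum_j g (lift2 j) *: 'X_j ^+ 3)%:F.
pose a : F2 := ((g ord_max)%:MP)%:F.
clearbody phi.
have phic : phi (\sum_i g i *: 'X_i ^+ 3) = a *: 'X^3 + e%:P.
  rewrite big_ord_recr /= -mul_mpolyC rmorphD rmorphM rmorphXn phiC phiXmax.
  rewrite -mul_polyC addrC; congr (_ + _); rewrite !rmorph_sum /=.
  rewrite /e !rmorph_sum; apply: eq_bigr => j _.
  rewrite -!mul_mpolyC [LHS]rmorphM rmorphXn phiC phiX.
  by rewrite /= tofracM tofracXn polyCM rmorphXn.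
have a_neq0 : a != 0 by rewrite tofrac_eq0 mpolyC_eq0.
have three_neq0 : 3%:R != 0 :> F2.
  rewrite -tofrac1 -tofracMn tofrac_eq0 -mpolyC1 -mpolyCMn mpolyC_eq0.
  by move: char3; rewrite inE.
have e_neq0 : e != 0.
  rewrite tofrac_eq0; apply/eqP => /(congr1 (mcoeff (U_(ord0) *+ 3)%MM)).
  by rewrite mcoeff_power_sum // mcoeff0; apply/eqP.
case/eqP: q_neq0; apply: (cubic_binomial_not_cube phi_inj three_neq0 a_neq0 e_neq0 phic pq).
Qed.

(** * Simple extensions of subfields *)

(** Subfields are [Prop] predicates, as in [extension_degree]. Closure under [x / y] includes
    [y = 0], where the quotient is 0. *)
Record subfield_pred (M : fieldType) := SubfieldPred {
  in_subfield :> M -> Prop;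
  in_subfield1 : in_subfield 1;
  in_subfieldB : forall x y, in_subfield x -> in_subfield y -> in_subfield (x - y);
  in_subfield_div : forall x y, in_subfield x -> in_subfield y -> in_subfield (x / y) }.

(** Excluded middle makes the predicate boolean, so that the subfield becomes a [fieldType] and
    polynomials over it can be divided. *)
Definition subfield_mem (M : fieldType) (E : subfield_pred M) : {pred M} :=
  fun x => if excluded_middle_informative (E x) then true else false.

Lemma subfield_memP (M : fieldType) (E : subfield_pred M) x :
  reflect (E x) (x \in subfield_mem E).
Proof. by rewrite unfold_in; case: excluded_middle_informative => ?; constructor. Qed.

Lemma subfield_mem_divring_closed (M : fieldType) (E : subfield_pred M) :
  divring_closed (subfield_mem E).
Proof.
split=> [|x y /subfield_memP Ex /subfield_memP Ey|x y /subfield_memP Ex /subfield_memP Ey];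
  apply/subfield_memP.
- exact: in_subfield1.
- exact: in_subfieldB.
- exact: in_subfield_div.
Qed.

HB.instance Definition _ (M : fieldType) (E : subfield_pred M) :=
  GRing.isDivringClosed.Build M (subfield_mem E) (subfield_mem_divring_closed E).

Record subfield_type (M : fieldType) (E : subfield_pred M) :=
  InSubfield { subfield_val : M; _ : subfield_val \in subfield_mem E }.

Section SubfieldType.
Variables (M : fieldType) (E : subfield_pred M).

HB.instance Definition _ := [isSub for @subfield_val M E].
HB.instance Definition _ := [Choice of subfield_type E by <:].
HB.instance Definition _ := [SubChoice_isSubIntegralDomain of subfield_type E by <:].
HB.instance Definition _ := [SubIntegralDomain_isSubField of subfield_type E by <:].

End SubfieldType.


Lemma in_subfield0 (M : fieldType) (E : subfield_pred M) : E 0.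
Proof. by rewrite -(subrr 1); apply: in_subfieldB; exact: in_subfield1. Qed.

Lemma in_subfieldM (M : fieldType) (E : subfield_pred M) x y :
  E x -> E y -> E (x * y).
Proof.
move=> Ex Ey; rewrite -[y]invrK -[y^-1]mul1r.
by apply: in_subfield_div => //; apply: in_subfield_div => //; exact: in_subfield1.
Qed.

Lemma in_subfieldD (M : fieldType) (E : subfield_pred M) x y :
  E x -> E y -> E (x + y).
Proof.
move=> Ex Ey; rewrite -[y]opprK; apply: in_subfieldB => //; rewrite -sub0r.
by apply: in_subfieldB => //; exact: in_subfield0.
Qed.

Lemma in_subfieldX (M : fieldType) (E : subfield_pred M) x n : E x -> E (x ^+ n).
Proof.
move=> Ex; elim: n => [|n IHn]; first exact: in_subfield1.
by rewrite exprS; apply: in_subfieldM.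
Qed.

Lemma in_subfield_sum (M : fieldType) (E : subfield_pred M) (I : Type)
    (r : seq I) (P : pred I) (F : I -> M) :
  (forall i, P i -> E (F i)) -> E (\sum_(i <- r | P i) F i).
Proof.
move=> EF; apply: (big_ind E) => //; first exact: in_subfield0.
by move=> x y; exact: in_subfieldD.
Qed.

Lemma in_subfield_prod (M : fieldType) (E : subfield_pred M) (I : Type)
    (r : seq I) (P : pred I) (F : I -> M) :
  (forall i, P i -> E (F i)) -> E (\prod_(i <- r | P i) F i).
Proof.
move=> EF; apply: (big_ind E) => //; first exact: in_subfield1.
by move=> x y; exact: in_subfieldM.
Qed.

Lemma exists_minimal_annihilator (F M : fieldType) (iota : {rmorphism F -> M})
    (t : M) (h : {poly F}) : h != 0 -> root (map_poly iota h) t ->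
  exists m : {poly F}, [/\ m != 0, root (map_poly iota m) t,
    (size m <= size h)%N
    & forall q, root (map_poly iota q) t -> (size q < size m)%N -> q = 0].
Proof.
have [n] := ubnP (size h); elim: n h => // n IHn h; rewrite ltnS => le_h_n h0 rt_h.
have [[q [q0 rt_q lt_q]] | min_h] := classic (exists q : {poly F},
    [/\ q != 0, root (map_poly iota q) t & (size q < size h)%N]).
  have [m [m0 rt_m le_m min_m]] := IHn q (leq_trans lt_q le_h_n) q0 rt_q.
  by exists m; split=> //; apply: leq_trans le_m (ltnW lt_q).
exists h; split=> // q rt_q lt_q; apply/eqP/negPn/negP => q0.
by apply: min_h; exists q.
Qed.

Section SimpleExtension.
Variables (F M : fieldType) (iota : {rmorphism F -> M}) (t : M) (m : {poly F}).
Hypotheses (m_neq0 : m != 0) (rt_m : root (map_poly iota m) t).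
Hypothesis min_m :
  forall q, root (map_poly iota q) t -> (size q < size m)%N -> q = 0.

Let adjoined (u : M) := exists q, u = (map_poly iota q).[t].

Lemma adjoined1 : adjoined 1.
Proof. by exists 1; rewrite rmorph1 hornerC. Qed.

Lemma adjoinedB x y : adjoined x -> adjoined y -> adjoined (x - y).
Proof. by case=> p -> [q ->]; exists (p - q); rewrite rmorphB !hornerE. Qed.

(** If q(t) != 0, the cofactor of gcd(q, m) in m still has the root t. By minimality of m the gcd is
    constant, and a Bezout identity inverts q(t). *)
Lemma adjoined_div x y : adjoined x -> adjoined y -> adjoined (x / y).
Proof.
case=> p -> [q ->]; have [|q_t] := eqVneq (map_poly iota q).[t] 0.
  by move->; rewrite invr0 mulr0; exists 0; rewrite rmorph0 horner0.
have /dvdpP[e m_e] := dvdp_gcdr q m.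
have gcd_t : (map_poly iota (gcdp q m)).[t] != 0.
  have /dvdpP[q' q_q'] := dvdp_gcdl q m.
  by apply: contraNneq q_t => g_t; rewrite {1}q_q' rmorphM hornerM g_t mulr0.
have e_neq0 : e != 0 by apply: contraNneq m_neq0 => e0; rewrite m_e e0 mul0r.
have g_neq0 : gcdp q m != 0 by rewrite gcdp_eq0 negb_and m_neq0 orbT.
have rt_e : root (map_poly iota e) t.
  by move: rt_m; rewrite {1}m_e rmorphM rootM => /orP[] // /eqP/eqP; rewrite (negPf gcd_t).
have /Bezout_eq1_coprimepP[[u v] /= uv] : coprimep q m.
  rewrite /coprimep eqn_leq size_poly_gt0 g_neq0 andbT leqNgt; apply/negP => g_gt1.
  case/eqP: (e_neq0); apply: min_m rt_e _.
  rewrite [in X in (_ < X)%N]m_e size_mul //.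
  rewrite -(prednK (n := size (gcdp q m))) ?size_poly_gt0 //.
  by rewrite addnS /= -[X in (X < _)%N]addn0 ltn_add2l -subn1 subn_gt0.
have uq : (map_poly iota u).[t] * (map_poly iota q).[t] = 1.
  have := congr1 (fun r => (map_poly iota r).[t]) uv.
  by rewrite rmorphD !rmorphM !hornerE /= (eqP rt_m) mulr0 addr0 rmorph1 hornerC.
exists (p * u); rewrite rmorphM hornerM; congr (_ * _).
by apply: (mulIf q_t); rewrite mulVf.
Qed.

Definition adjoin_subfield := SubfieldPred adjoined1 adjoinedB adjoined_div.

(** The basis consists of the powers of [t] below the degree of [m]: they span by division by [m],
    and a relation between them is a polynomial smaller than [m] with root [t]. *)
Lemma simple_extension_degree (E L : M -> Prop) :
  (forall x, E x <-> exists y, x = iota y) ->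
  (forall i, L (t ^+ i)) -> (forall u, L u -> adjoin_subfield u) ->
  extension_degree E L (size m).-1.
Proof.
move=> E_im L_t L_sub.
have sz_m : size m = (size m).-1.+1 by rewrite prednK // size_poly_gt0.
exists (fun i => t ^+ i); split=> [i|u /L_sub[q ->]|c Ec c_t i]; first exact: L_t.
  pose r := q %% m; exists (fun i => iota r`_i).
    by move=> i; apply: (proj2 (E_im _)); exists r`_i.
  rewrite (divp_eq q m) -/r rmorphD rmorphM !hornerE /= (eqP rt_m) mulr0 add0r.
  rewrite (@horner_coef_wide _ (size m).-1).
    by apply: eq_bigr => i _; rewrite coef_map.
  by rewrite size_map_poly -ltnS -sz_m ltn_modp.
have /fin_all_exists[y cy] : forall j, exists y, c j = iota y.
  by move=> j; apply: (proj1 (E_im _)).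
pose r := \poly_(j < (size m).-1) (if insub j is Some j' then y j' else 0).
have rE j : r`_(nat_of_ord j) = y j.
  by rewrite coef_poly ltn_ord insubT // => lt_j; congr (y _); apply: val_inj.
rewrite cy -rE; suff -> : r = 0 by rewrite coef0 rmorph0.
apply: min_m; last by rewrite [in X in (_ < X)%N]sz_m ltnS size_poly.
apply/rootP; rewrite (@horner_coef_wide _ (size m).-1) ?size_map_poly ?size_poly //.
by rewrite -[RHS]c_t; apply: eq_bigr => j _; rewrite coef_map /= rE cy.
Qed.

End SimpleExtension.

(** [h] may be reducible, so the degree is that of a minimal annihilator of [t]. Generation of [L]
    by [t] over [E] is stated through all subfields [D], and used with [D] the field E[t]. *)
Lemma extension_degree_le (M : fieldType) (E : subfield_pred M) (L : M -> Prop)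
    (t : M) (h : {poly M}) (n : nat) :
  h != 0 -> (size h <= n.+1)%N -> (forall i, E h`_i) -> root h t ->
  (forall i, L (t ^+ i)) ->
  (forall (D : subfield_pred M), (forall x, E x -> D x) -> D t ->
     forall u, L u -> D u) ->
  exists2 k, (k <= n)%N & extension_degree E L k.
Proof.
move=> h_neq0 h_le E_h rt_h L_t L_gen.
pose iota : {rmorphism subfield_type E -> M} := (\val : subfield_type E -> M).
have E_im x : E x <-> exists y, x = iota y.
  split=> [Ex | [y ->]]; last by apply/subfield_memP; apply: (valP y).
  by exists (InSubfield (introT (subfield_memP _ _) Ex)).
have [h' h_h'] : exists h', h = map_poly iota h'.
  have /fin_all_exists[y hy] : forall i : 'I_(size h), exists y, h`_i = iota y.
    by move=> i; apply: (proj1 (E_im _)).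
  exists (\poly_(i < size h) (if insub i is Some i' then y i' else 0)).
  apply/polyP => i; rewrite coef_map coef_poly; case: ltnP => [lt_i | le_i].
    by rewrite (insubT (fun j => j < size h)%N lt_i); exact: (hy (Ordinal lt_i)).
  by rewrite nth_default //; apply: esym; exact: (rmorph0 iota).
rewrite h_h' in h_neq0 h_le rt_h.
have h'_neq0 : h' != 0 by apply: contraNneq h_neq0 => ->; rewrite rmorph0.
have [m [m_neq0 rt_m le_m min_m]] := exists_minimal_annihilator h'_neq0 rt_h.
exists (size m).-1; last first.
  apply: (@simple_extension_degree _ _ iota t m m_neq0 rt_m min_m E L E_im L_t).
  apply: L_gen => [x /E_im[y ->] | ]; first by exists y%:P; rewrite map_polyC hornerC.
  by exists 'X; rewrite map_polyX hornerX.
move: h_le; rewrite size_map_poly => h_le.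
by rewrite -ltnS prednK ?size_poly_gt0 // (leq_trans le_m).
Qed.

(** * The generic point of a diagonal cubic surface *)

Lemma mpoly_generation (K : comNzRingType) (n : nat) (P : {mpoly K[n]} -> Prop) :
  (forall c, P c%:MP) -> (forall p q, P p -> P q -> P (p + q)) ->
  (forall i p, P p -> P (p * 'X_i)) -> forall p, P p.
Proof.
move=> PC PD PX p; rewrite [p]mpolyE.
apply: (big_ind P) => [||m _]; [by rewrite -mpolyC0 | exact: PD |].
rewrite -mul_mpolyC mpolyXE_id.
suff PM q : P q -> P (q * \prod_i 'X_i ^+ m i) by apply: PM.
apply: (big_ind (fun r => forall q, P q -> P (q * r))) => {q}.
- by move=> q; rewrite mulr1.
- by move=> r1 r2 IH1 IH2 q Pq; rewrite mulrA; apply/IH2/IH1.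
move=> i _; elim: (m i) => [|k IHk] q Pq; first by rewrite mulr1.
by rewrite exprS mulrA; apply/IHk/PX.
Qed.

Lemma irreducible_root_eq0 (F L : fieldType) (iota : {rmorphism F -> L}) (z : L)
    (p r : {poly F}) : irreducible_poly p -> root (map_poly iota p) z ->
  root (map_poly iota r) z -> (size r < size p)%N -> r = 0.
Proof.
move=> irr_p rt_p rt_r lt_rp; apply/eqP/negPn/negP => r_neq0.
have /Bezout_eq1_coprimepP[[u v] /= uv] : coprimep p r.
  rewrite irreducible_poly_coprime //; apply/negP => /(dvdp_leq r_neq0).
  by rewrite leqNgt lt_rp.
have := congr1 (fun q => (map_poly iota q).[z]) uv.
rewrite rmorphD !rmorphM !hornerE /= (eqP rt_p) (eqP rt_r) !mulr0 addr0.
by rewrite rmorph1 hornerC => /eqP; rewrite eq_sym oner_eq0.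
Qed.

Lemma cubic_root_free (F L : fieldType) (iota : {rmorphism F -> L}) (z : L)
    (c r0 r1 r2 : F) :
  irreducible_poly ('X^3 - c%:P) -> z ^+ 3 = iota c ->
  iota r0 + iota r1 * z + iota r2 * z ^+ 2 = 0 -> [/\ r0 = 0, r1 = 0 & r2 = 0].
Proof.
move=> irr z3 rz; pose r := r0%:P + r1%:P * 'X + r2%:P * 'X^2.
have r_eq0 : r = 0.
  apply: (@irreducible_root_eq0 _ _ iota z) irr _ _ _.
  - by rewrite /root rmorphB /= map_polyXn map_polyC !hornerE z3 subrr.
  - by rewrite /root !rmorphD !rmorphM /= map_polyX !map_polyC !hornerE /= -mulrA -expr2 rz.
  rewrite size_XnsubC // ltnS.
  apply/leq_sizeP => j le_3j; rewrite !coefD !coefCM coefX coefXn coefC.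
  by case: j le_3j => [|[|[|j]]] //= _; rewrite !mulr0 !addr0.
have r_coef k : r`_k = 0 by rewrite r_eq0 coef0.
by split; [have := r_coef 0%N | have := r_coef 1%N | have := r_coef 2%N];
  rewrite !coefD !coefCM coefX coefXn !coefC /= !(mulr0, mulr1, addr0, add0r).
Qed.

Definition diagonal_form (K : nzRingType) (b : 'I_4 -> K) : {mpoly K[4]} :=
  \sum_i b i *: 'X_i ^+ 3.

Section GenericPoint.
Variables (K : fieldType) (b : 'I_4 -> K).
Hypotheses (char3 : 3%N \notin [pchar K]) (b_neq0 : forall i, b i != 0).

Local Notation f := (diagonal_form b).
Let up (r : {mpoly K[3]}) : {mpoly K[4]} :=
  r \mPo [tuple 'X_(lift ord0 j) | j < 3].
Let g (j : 'I_3) := - (b (lift ord0 j) / b ord0).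
Let c : {mpoly K[3]} := \sum_j g j *: 'X_j ^+ 3.

Let upD r r' : up (r + r') = up r + up r'.
Proof. exact: rmorphD. Qed.

Let upM r r' : up (r * r') = up r * up r'.
Proof. exact: rmorphM. Qed.

Let upX j : up 'X_j = 'X_(lift ord0 j).
Proof. by rewrite /up comp_mpolyXU -tnth_nth tnth_mktuple. Qed.

Let cubeX0 : 'X_ord0 ^+ 3 = (b ord0)^-1 *: f + up c.
Proof.
rewrite /diagonal_form big_ord_recl scalerDr scalerA mulVf // scale1r.
rewrite -addrA scaler_sumr /up rmorph_sum -big_split big1 ?addr0 // => j _ /=.
rewrite comp_mpolyZ; rewrite rmorphXn /= -[comp_mpoly _ _]/(up _) upX.
rewrite scalerA -scalerDl /g.
by rewrite [_^-1 * _]mulrC addrN scale0r.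
Qed.

(** Division by f as a cubic in ['X_ord0], whose leading coefficient [b ord0] is a unit. *)
Let division_by_diagonal_form G : exists Q r0 r1 r2,
  G = Q * f + up r0 + up r1 * 'X_ord0 + up r2 * 'X_ord0 ^+ 2.
Proof.
elim/mpoly_generation: G => [a|p q|i p].
- exists 0, a%:MP, 0, 0; rewrite /up comp_mpolyC rmorph0; by ring.
- move=> [Q [r0 [r1 [r2 ->]]]] [Q' [r0' [r1' [r2' ->]]]].
  by exists (Q + Q'), (r0 + r0'), (r1 + r1'), (r2 + r2'); rewrite !upD; ring.
move=> [Q [r0 [r1 [r2 ->]]]]; case: (unliftP ord0 i) => [j ->|->].
  exists (Q * 'X_(lift ord0 j)), (r0 * 'X_j), (r1 * 'X_j), (r2 * 'X_j).
  by rewrite !upM upX; ring.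
(* Multiplication by ['X_ord0] shifts the remainders, and the cube that appears is replaced through
   [cubeX0]. *)
exists (Q * 'X_ord0 + up r2 * (b ord0)^-1%:MP), (r2 * c), r0, r1.
have := cubeX0; rewrite -mul_mpolyC => X3.
by rewrite upM; ring: X3.
Qed.

(** The point has three independent variables and a cube root z of [c] as coordinates. As [c] is not
    a cube, 1, z, z^2 are linearly independent, so a polynomial vanishing at the point has zero
    remainder on division by f. *)
Lemma exists_generic_point :
  exists (L : fieldType) (iota : {rmorphism K -> L}) (s : 'I_4 -> L),
    mmap iota s f = 0 /\ forall G, mmap iota s G = 0 -> vanishes_on f G.
Proof.
have irr : irreducible_poly ('X^3 - (c%:F)%:P).
  apply: cubic_irreducible => [|x]; first by rewrite size_XnsubC.
  rewrite /root !hornerE subr_eq0; apply: fermat_cubic_not_cube => // j.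
  by rewrite oppr_eq0 mulf_neq0 ?invr_eq0.
have [|L [kappa [z rt_z]]] := @exists_root_in_extension _ ('X^3 - (c%:F)%:P).
  by rewrite size_XnsubC.
have z3 : z ^+ 3 = kappa c%:F.
  apply/eqP; rewrite -subr_eq0; move: rt_z.
  by rewrite /root rmorphB /= map_polyXn map_polyC !hornerE.
pose iota : {rmorphism K -> L} := kappa \o @FracField.tofrac _ \o @mpolyC 3 K.
pose s i := if unlift ord0 i is Some j then kappa ('X_j)%:F else z.
have s_up r : mmap iota s (up r) = kappa r%:F.
  pose psi : {rmorphism {mpoly K[3]} -> L} := kappa \o @FracField.tofrac _.
  rewrite mmap_comp_mpoly -[RHS]/(psi r) [RHS]rmorph_mpolyE; apply: mmap_ext => // j.
  by rewrite tnth_mktuple mmapX mmap1U /s liftK.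
have sX0 : mmap iota s 'X_ord0 = z by rewrite mmapX mmap1U /s unlift_none.
have sf : mmap iota s f = 0.
  have := congr1 (mmap iota s) cubeX0.
  rewrite rmorphXn rmorphD /= sX0 z3 s_up mmapZ => /eqP.
  rewrite -subr_eq0 opprD addrCA subrr addr0 oppr_eq0 mulf_eq0.
  by rewrite fmorph_eq0 invr_eq0 (negPf (b_neq0 _)) => /eqP.
exists L, iota, s; split=> // G.
have [Q [r0 [r1 [r2 ->]]]] := division_by_diagonal_form G.
rewrite !rmorphD !rmorphM /= !s_up sX0 sf mulr0 add0r ; rewrite -expr2 => s_r.
have [] := cubic_root_free irr z3 s_r.
move/eqP; rewrite tofrac_eq0 => /eqP-> /eqP; rewrite tofrac_eq0 => /eqP-> /eqP.
rewrite tofrac_eq0 => /eqP->; exists Q.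
by rewrite /up rmorph0; ring.
Qed.

End GenericPoint.

(** * Lines on and tangent to a diagonal cubic *)

Lemma mem_uniq_ord (n : nat) (r : seq 'I_n) (i : 'I_n) :
  uniq r -> size r = n -> i \in r.
Proof.
move=> uniq_r sz_r.
have [] // := uniq_min_size uniq_r (s2 := enum 'I_n) => [j||_ ->]; rewrite ?mem_enum //.
by rewrite size_enum_ord sz_r.
Qed.

Lemma big_uniq4 (R : nmodType) (i1 i2 i3 i4 : 'I_4) (F : 'I_4 -> R) :
  uniq [:: i1; i2; i3; i4] -> \sum_i F i = F i1 + (F i2 + (F i3 + F i4)).
Proof.
move=> uniq_s; rewrite -big_enum (perm_big [:: i1; i2; i3; i4]) /=.
  by rewrite !big_cons big_nil addr0.
by apply: uniq_perm; rewrite ?enum_uniq // => i; rewrite mem_enum mem_uniq_ord.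
Qed.

Lemma exists_notin_ord (n : nat) (r : seq 'I_n) :
  (size r < n)%N -> exists i, i \notin r.
Proof.
move=> lt_rn; apply: NNPP => no_i; move: lt_rn; rewrite ltnNge => /negP; apply.
rewrite -[X in (X <= _)%N](size_enum_ord n); apply: uniq_leq_size (enum_uniq _) _ => i _.
by apply/negPn/negP => iN; apply: no_i; exists i.
Qed.

Lemma exists_fourth_index (i2 i3 i4 : 'I_4) :
  uniq [:: i2; i3; i4] -> exists i1, uniq [:: i1; i2; i3; i4].
Proof.
move=> uniq_s; have [i1 i1P] := @exists_notin_ord 4 [:: i2; i3; i4] isT.
by exists i1; rewrite cons_uniq i1P.
Qed.

Section EqualNodes.
Variable L : fieldType.

(** Three nodes remain, [r0] with weight [b0 + b1]. The weighted sum of the values of (X - r2)(X -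
    r3) keeps only the node [r0], so one of [r2], [r3] equals it; the linear relation settles the
    other. *)
Lemma equal_nodes_of_eq (b0 b1 b2 b3 r0 r2 r3 : L) :
  b2 != 0 -> b3 != 0 -> b0 + b1 != 0 ->
  b0 + b1 + b2 + b3 = 0 ->
  b0 * r0 + b1 * r0 + b2 * r2 + b3 * r3 = 0 ->
  b0 * r0 ^+ 2 + b1 * r0 ^+ 2 + b2 * r2 ^+ 2 + b3 * r3 ^+ 2 = 0 ->
  r2 = r0 /\ r3 = r0.
Proof.
move=> b2_neq0 b3_neq0 b01_neq0 e0 e1 e2.
have step : r2 = r0 \/ r3 = r0.
  have : (b0 + b1) * ((r2 - r0) * (r3 - r0)) = 0.
    transitivity ((b0 * r0 ^+ 2 + b1 * r0 ^+ 2 + b2 * r2 ^+ 2 + b3 * r3 ^+ 2)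
      - (r2 + r3) * (b0 * r0 + b1 * r0 + b2 * r2 + b3 * r3)
      + r2 * r3 * (b0 + b1 + b2 + b3)); first by ring.
    by rewrite e0 e1 e2; ring.
  move/eqP; rewrite !mulf_eq0 (negPf b01_neq0) /= !subr_eq0.
  by case/orP=> /eqP; [left | right].
case: step => E; rewrite E in e1 *; split=> //; apply/eqP; rewrite -subr_eq0.
  rewrite -(inj_eq (mulfI b3_neq0)) mulr0; apply/eqP.
  transitivity ((b0 * r0 + b1 * r0 + b2 * r0 + b3 * r3) - r0 * (b0 + b1 + b2 + b3)).
    by ring.
  by rewrite e0 e1; ring.
rewrite -(inj_eq (mulfI b2_neq0)) mulr0; apply/eqP.
transitivity ((b0 * r0 + b1 * r0 + b2 * r2 + b3 * r0) - r0 * (b0 + b1 + b2 + b3)).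
  by ring.
by rewrite e0 e1; ring.
Qed.

(* A Vandermonde argument: the weights carried by each of the at most four
   distinct nodes sum to 0, and no proper nonempty subset of the weights does. *)
Lemma equal_nodes (b0 b1 b2 b3 r0 r1 r2 r3 : L) :
  b0 != 0 -> b1 != 0 -> b2 != 0 -> b3 != 0 ->
  b0 + b1 != 0 -> b0 + b2 != 0 -> b0 + b3 != 0 ->
  b0 + b1 + b2 + b3 = 0 ->
  b0 * r0 + b1 * r1 + b2 * r2 + b3 * r3 = 0 ->
  b0 * r0 ^+ 2 + b1 * r1 ^+ 2 + b2 * r2 ^+ 2 + b3 * r3 ^+ 2 = 0 ->
  b0 * r0 ^+ 3 + b1 * r1 ^+ 3 + b2 * r2 ^+ 3 + b3 * r3 ^+ 3 = 0 ->
  [/\ r1 = r0, r2 = r0 & r3 = r0].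
Proof.
move=> b0_neq0 b1_neq0 b2_neq0 b3_neq0 b01 b02 b03 e0 e1 e2 e3.
have : b0 * ((r1 - r0) * ((r2 - r0) * (r3 - r0))) = 0.
  transitivity (- (b0 * r0 ^+ 3 + b1 * r1 ^+ 3 + b2 * r2 ^+ 3 + b3 * r3 ^+ 3)
    + (r1 + r2 + r3) * (b0 * r0 ^+ 2 + b1 * r1 ^+ 2 + b2 * r2 ^+ 2 + b3 * r3 ^+ 2)
    - (r1 * r2 + r1 * r3 + r2 * r3) * (b0 * r0 + b1 * r1 + b2 * r2 + b3 * r3)
    + r1 * r2 * r3 * (b0 + b1 + b2 + b3)); first by ring.
  by rewrite e0 e1 e2 e3; ring.
move/eqP; rewrite !mulf_eq0 (negPf b0_neq0) /= !subr_eq0.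
case/or3P=> /eqP E; rewrite E in e1 e2 *.
- by have [] := equal_nodes_of_eq b2_neq0 b3_neq0 b01 e0 e1 e2.
- have e1' : b0 * r0 + b2 * r0 + b1 * r1 + b3 * r3 = 0 by rewrite -e1; ring.
  have e2' : b0 * r0 ^+ 2 + b2 * r0 ^+ 2 + b1 * r1 ^+ 2 + b3 * r3 ^+ 2 = 0.
    by rewrite -e2; ring.
  have e0' : b0 + b2 + b1 + b3 = 0 by rewrite -e0; ring.
  by have [-> ->] := equal_nodes_of_eq b1_neq0 b3_neq0 b02 e0' e1' e2'.
have e1' : b0 * r0 + b3 * r0 + b1 * r1 + b2 * r2 = 0 by rewrite -e1; ring.
have e2' : b0 * r0 ^+ 2 + b3 * r0 ^+ 2 + b1 * r1 ^+ 2 + b2 * r2 ^+ 2 = 0.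
  by rewrite -e2; ring.
have e0' : b0 + b3 + b1 + b2 = 0 by rewrite -e0; ring.
by have [-> ->] := equal_nodes_of_eq b1_neq0 b2_neq0 b03 e0' e1' e2'.
Qed.

End EqualNodes.

(** * Residual points of tangent lines *)

Section ThirdPoint.
Variable R : comNzRingType.
Implicit Types b P w : 'I_4 -> R.

(* If the line through [P] in direction [w] is tangent at [P] to the cubic
   [\sum_i b i * X_i ^ 3 = 0], this is its residual point. *)
Definition third_point b P w (i : 'I_4) : R :=
  (\sum_j b j * w j ^+ 3) * P i - 3%:R * (\sum_j b j * P j * w j ^+ 2) * w i.

(** For P on the cubic and w tangent at P, the equation at x P + y w is y^2 (3 q x + c y), with q
    and c as in the proof; its residual root is x = c, y = - 3 q. *)
Lemma third_point_on b P w :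
  \sum_i b i * P i ^+ 3 = 0 -> \sum_i b i * P i ^+ 2 * w i = 0 ->
  \sum_i b i * third_point b P w i ^+ 3 = 0.
Proof.
move=> fP lw; rewrite /third_point.
set c := \sum_j b j * w j ^+ 3; set q := \sum_j _ * _ * w j ^+ 2.
have cE : \sum_i b i * w i ^+ 3 = c by [].
have qE : \sum_i b i * P i * w i ^+ 2 = q by [].
clearbody c q.
transitivity (c ^+ 3 * (\sum_i b i * P i ^+ 3)
  - 9%:R * c ^+ 2 * q * (\sum_i b i * P i ^+ 2 * w i)
  + 27%:R * c * q ^+ 2 * (\sum_i b i * P i * w i ^+ 2)
  - 27%:R * q ^+ 3 * (\sum_i b i * w i ^+ 3)); last by rewrite fP lw cE qE; ring.
rewrite !mulr_sumr -!sumrN -!big_split /=.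
by apply: eq_bigr => i _; ring.
Qed.

(** The whole line lies in the tangent plane at [P]. In the degree computation this makes the
    parameter a root of [polar_poly]. *)
Lemma third_point_tangent b P w :
  \sum_i b i * P i ^+ 3 = 0 -> \sum_i b i * P i ^+ 2 * w i = 0 ->
  \sum_i b i * P i ^+ 2 * third_point b P w i = 0.
Proof.
move=> fP lw; rewrite /third_point.
set c := \sum_j b j * w j ^+ 3; set q := \sum_j _ * _ * w j ^+ 2; clearbody c q.
transitivity (c * (\sum_i b i * P i ^+ 3)
  - 3%:R * q * (\sum_i b i * P i ^+ 2 * w i)); last by rewrite fP lw; ring.
rewrite !mulr_sumr -!sumrN -!big_split /=.
by apply: eq_bigr => i _; ring.
Qed.

Lemma third_point_scale b P w (a m : R) i :
  third_point b (fun j => a * P j) (fun j => m * w j) i =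
  a * m ^+ 3 * third_point b P w i.
Proof.
rewrite /third_point.
have -> : \sum_j b j * (m * w j) ^+ 3 = m ^+ 3 * \sum_j b j * w j ^+ 3.
  by rewrite mulr_sumr; apply: eq_bigr => j _; ring.
have -> : \sum_j b j * (a * P j) * (m * w j) ^+ 2 =
          a * m ^+ 2 * \sum_j b j * P j * w j ^+ 2.
  by rewrite mulr_sumr; apply: eq_bigr => j _; ring.
by ring.
Qed.

(* [w] is the direction of the line through [P] and [s], normalised to vanish at
   [i4]: the residual point of that line is again [s]. *)
Lemma third_point_direction b P s (i4 : 'I_4) (w := fun i => P i4 * s i - s i4 * P i) :
  \sum_i b i * P i ^+ 3 = 0 -> \sum_i b i * s i ^+ 3 = 0 ->
  \sum_i b i * P i ^+ 2 * s i = 0 ->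
  [/\ \sum_i b i * P i ^+ 2 * w i = 0,
      \sum_i b i * P i * w i ^+ 2 = P i4 ^+ 2 * \sum_i b i * P i * s i ^+ 2
    & forall i, third_point b P w i =
        - 3%:R * P i4 ^+ 3 * (\sum_j b j * P j * s j ^+ 2) * s i].
Proof.
move=> fP fs lPs; set q := \sum_i b i * P i * s i ^+ 2.
have w_q : \sum_i b i * P i * w i ^+ 2 = P i4 ^+ 2 * q.
  transitivity (P i4 ^+ 2 * q - 2%:R * P i4 * s i4 * (\sum_i b i * P i ^+ 2 * s i)
    + s i4 ^+ 2 * (\sum_i b i * P i ^+ 3)); last by rewrite fP lPs; ring.
  rewrite /q !mulr_sumr -!sumrN -!big_split /=.
  by apply: eq_bigr => i _; rewrite /w; ring.
have w_c : \sum_i b i * w i ^+ 3 = - 3%:R * s i4 * P i4 ^+ 2 * q.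
  transitivity (P i4 ^+ 3 * (\sum_i b i * s i ^+ 3)
    - 3%:R * s i4 * P i4 ^+ 2 * q
    + 3%:R * P i4 * s i4 ^+ 2 * (\sum_i b i * P i ^+ 2 * s i)
    - s i4 ^+ 3 * (\sum_i b i * P i ^+ 3)); last by rewrite fP fs lPs; ring.
  rewrite /q !mulr_sumr -!sumrN -!big_split /=.
  by apply: eq_bigr => i _; rewrite /w; ring.
split=> // [|i].
  transitivity (P i4 * (\sum_i b i * P i ^+ 2 * s i)
    - s i4 * (\sum_i b i * P i ^+ 3)); last by rewrite fP lPs; ring.
  rewrite !mulr_sumr -!sumrN -!big_split /=.
  by apply: eq_bigr => i _; rewrite /w; ring.
by rewrite /third_point w_c w_q /w; ring.
Qed.

(* The direction in the tangent plane at [P] with [i1]-th and [i3]-th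
   coordinates in the ratio [y2 : y0] and [i4]-th coordinate 0. *)
Definition tangent_direction b P (i1 i2 i3 : 'I_4) (y0 y2 : R) (i : 'I_4) : R :=
  let l j := b j * P j ^+ 2 in
  if i == i1 then y2 * l i2 else if i == i3 then y0 * l i2
  else if i == i2 then - (y2 * l i1 + y0 * l i3) else 0.

Lemma tangent_directionP b P i1 i2 i3 i4 y0 y2 :
  uniq [:: i1; i2; i3; i4] ->
  \sum_i b i * P i ^+ 2 * tangent_direction b P i1 i2 i3 y0 y2 i = 0.
Proof.
move=> uniq_i; rewrite (big_uniq4 _ uniq_i) /tangent_direction /= !eqxx.
move: uniq_i; rewrite /= !inE !negb_or -!andbA.
case/and4P=> n12 n13 n14 /and4P[n23 n24 n34 _].
rewrite ![i2 == _]eq_sym ![i3 == i1]eq_sym ![i4 == _]eq_sym.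
rewrite !(negPf n12) !(negPf n13) !(negPf n14) !(negPf n24) !(negPf n34).
rewrite [i3 == i2]eq_sym (negPf n23).
by ring.
Qed.

End ThirdPoint.

Lemma dhomog_power_sum (K : nzRingType) (n k : nat) (m : 'I_n -> K) :
  \sum_i m i *: 'X_i ^+ k \is k.-homog.
Proof.
apply: rpred_sum => i _; apply: rpredZ.
have X1 : ('X_i : {mpoly K[n]}) \is 1.-homog by rewrite dhomogX /= mdeg1.
by have := dhomogMn k X1; rewrite mul1n.
Qed.

(** Degrees add up, so a multiple of the cubic form that has degree at most 3 has a constant
    cofactor. *)
Lemma vanishes_on_power_sum (K : fieldType) (b m : 'I_4 -> K) (k : nat) :
  (forall i, b i != 0) -> (0 < k <= 3)%N ->
  vanishes_on (diagonal_form b) (\sum_i m i *: 'X_i ^+ k) ->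
  exists a : K, \sum_i m i *: 'X_i ^+ k = a *: diagonal_form b.
Proof.
move=> b_neq0 /andP[k_gt0 k_le3] [Q GQ].
have [Q0|Q_neq0] := eqVneq Q 0; first by exists 0; rewrite GQ Q0 mul0r scale0r.
have f_coef : (diagonal_form b)@_(U_(ord0) *+ 3)%MM != 0 by rewrite mcoeff_power_sum.
have f_neq0 : diagonal_form b != 0.
  by apply: contraNneq f_coef => ->; rewrite mcoeff0.
have le_f : (3 < msize (diagonal_form b))%N.
  have := @msize_mdeg_lt _ _ (diagonal_form b) (U_(ord0) *+ 3)%MM.
  by rewrite mcoeff_msupp f_coef mdegMn mdeg1 => /(_ isT).
have le_G : (msize (Q * diagonal_form b) <= 4)%N.
  rewrite -GQ msizeE; apply/bigmax_leqP_seq => M M_in _.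
  by rewrite ltnS (dhomogP _ _ _ (dhomog_power_sum k m) M M_in).
have : (msize Q <= 1)%N.
  rewrite msizeM // in le_G.
  move: le_f le_G; set u := msize Q; set v := msize (diagonal_form b).
  by case: v => [|v]; rewrite ?addnS /=; lia.
by move/msize1_polyC => QC; exists Q@_0; rewrite GQ {1}QC mul_mpolyC.
Qed.

Lemma equal_nodes_ord (L : fieldType) (w r : 'I_4 -> L) :
  (forall i, w i != 0) -> (forall i j, i != j -> w i + w j != 0) ->
  (forall k, (k <= 3)%N -> \sum_i w i * r i ^+ k = 0) -> forall i, r i = r ord0.
Proof.
move=> w_neq0 ww_neq0 wr.
pose i1 : 'I_4 := @Ordinal 4 1 isT; pose i2 : 'I_4 := @Ordinal 4 2 isT.
pose i3 : 'I_4 := @Ordinal 4 3 isT.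
have wr4 k : (k <= 3)%N -> w ord0 * r ord0 ^+ k + w i1 * r i1 ^+ k
    + w i2 * r i2 ^+ k + w i3 * r i3 ^+ k = 0.
  move=> /wr <-; rewrite (@big_uniq4 _ ord0 i1 i2 i3) //; by ring.
have [|||||||||||r1 r2 r3] := @equal_nodes _ (w ord0) (w i1) (w i2) (w i3)
  (r ord0) (r i1) (r i2) (r i3); rewrite ?w_neq0 ?ww_neq0 //.
- by have := wr4 0%N isT; rewrite !mulr1.
- exact: wr4 1%N isT.
- exact: wr4 2%N isT.
- exact: wr4 3%N isT.
have eq_ord (i j : 'I_4) : val i = val j -> r i = r j by move=> /val_inj->.
case=> [[|[|[|[|m]]]] lt_i] //; first exact: eq_ord.
- by rewrite -r1; apply: eq_ord.
- by rewrite -r2; apply: eq_ord.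
- by rewrite -r3; apply: eq_ord.
Qed.

(** * Relations over K between the coordinates of a generic point *)

Section GenericRelations.
Variables (K L : fieldType) (iota : {rmorphism K -> L}) (b : 'I_4 -> K) (s : 'I_4 -> L).
Hypotheses (b_neq0 : forall i, b i != 0)
  (gen_s : forall d (G : {mpoly K[4]}), G \is d.-homog -> mmap iota s G = 0 ->
     vanishes_on (diagonal_form b) G).

Lemma mmap_power_sum (m : 'I_4 -> K) k :
  mmap iota s (\sum_i m i *: 'X_i ^+ k) = \sum_i iota (m i) * s i ^+ k.
Proof.
by rewrite rmorph_sum; apply: eq_bigr => i _; rewrite /= mmapZ rmorphXn /= mmapX mmap1U.
Qed.

(** The linear form would be [a] times f; it has no cubic monomial, while f has coefficient [b i] at
    the cube of ['X_i], so [a] is 0. *)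
Lemma generic_linear_relation (m : 'I_4 -> K) :
  \sum_i iota (m i) * s i = 0 -> forall i, m i = 0.
Proof.
move=> ms i; have : mmap iota s (\sum_i m i *: 'X_i ^+ 1) = 0.
  by rewrite mmap_power_sum -[RHS]ms; apply: eq_bigr => j _; rewrite expr1.
move/(gen_s (dhomog_power_sum _ _))/(vanishes_on_power_sum b_neq0) => /(_ isT)[a Ga].
have a0 : a = 0.
  have := congr1 (mcoeff (U_(i) *+ 3)%MM) Ga; rewrite mcoeffZ mcoeff_power_sum //.
  rewrite (dhomog_nemf_coeff (dhomog_power_sum 1 m)) /= ?mdegMn ?mdeg1 //.
  by move/esym/eqP; rewrite mulf_eq0 (negPf (b_neq0 i)) orbF => /eqP.
have := congr1 (mcoeff (U_(i) *+ 1)%MM) Ga.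
by rewrite mcoeff_power_sum // a0 scale0r mcoeff0.
Qed.

Lemma generic_cubic_relation (m : 'I_4 -> K) :
  \sum_i iota (m i) * s i ^+ 3 = 0 -> exists a, forall i, m i = a * b i.
Proof.
rewrite -mmap_power_sum => /(gen_s (dhomog_power_sum _ _)).
move/(vanishes_on_power_sum b_neq0) => /(_ isT)[a Ga].
exists a => i; have := congr1 (mcoeff (U_(i) *+ 3)%MM) Ga.
by rewrite mcoeffZ !mcoeff_power_sum.
Qed.

(** The polar quadric of [s] restricted to the curve [p]: its roots are the parameters of the points
    whose tangent plane contains [s]. *)
Definition polar_poly (p : 'I_4 -> {poly K}) : {poly L} :=
  \sum_i (iota (b i) * s i) *: map_poly iota (p i ^+ 2).

Lemma coef_polar_poly p n :
  (polar_poly p)`_n = \sum_i iota (b i * (p i ^+ 2)`_n) * s i.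
Proof.
rewrite coef_sum; apply: eq_bigr => i _.
by rewrite coefZ coef_map /= rmorphM mulrAC.
Qed.

Lemma horner_polar_poly p t :
  (polar_poly p).[t] = \sum_i iota (b i) * (map_poly iota (p i)).[t] ^+ 2 * s i.
Proof.
rewrite horner_sum; apply: eq_bigr => i _.
by rewrite hornerZ rmorphXn horner_exp mulrAC.
Qed.

(** The four terms cannot cancel: each coefficient is a linear form over K in the coordinates of
    [s], and these are linearly independent. *)
Lemma generic_polar_coef_neq0 p k :
  p k != 0 -> (polar_poly p)`_(size (p k ^+ 2)).-1 != 0.
Proof.
move=> pk0; rewrite coef_polar_poly; apply/eqP => rel.
have /eqP := generic_linear_relation rel k.
rewrite mulf_eq0 (negPf (b_neq0 k)) /= -[_`_ _]/(lead_coef _) lead_coef_eq0.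
by rewrite expf_eq0 /= (negPf pk0).
Qed.

Lemma generic_coord_neq0 i : s i != 0.
Proof.
apply/eqP => si0; have rel : \sum_j iota (j == i)%:R * s j = 0.
  rewrite big1 // => j _; have [->|_] := eqVneq j i; first by rewrite si0 mulr0.
  by rewrite rmorph0 mul0r.
by have /eqP := generic_linear_relation rel i; rewrite eqxx oner_eq0.
Qed.

(** This is the condition on pairs of weights in [equal_nodes]. Otherwise the two-term form would be
    a multiple of f, by the factor 1 in view of its coefficient at [i], whereas f has further
    nonzero coefficients. *)
Lemma generic_pair_neq0 i j : i != j ->
  iota (b i) * s i ^+ 3 + iota (b j) * s j ^+ 3 != 0.
Proof.
move=> neq_ij; apply/eqP => ij0.
have [|a ma] := @generic_cubic_relation (fun k => if (k == i) || (k == j) then b k else 0).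
  rewrite (bigD1 i) //= (bigD1 j) /=; last by rewrite eq_sym.
  rewrite !eqxx orbT addrA ij0 add0r.
  by rewrite big1 // => k /andP[/negPf-> /negPf->]; rewrite rmorph0 mul0r.
have a1 : a = 1.
  by apply: (mulIf (b_neq0 i)); rewrite -ma eqxx mul1r.
have [k] := @exists_notin_ord 4 [:: i; j] isT.
rewrite !inE => /negPf kN; have := ma k; rewrite kN a1 mul1r => /esym/eqP.
by rewrite (negPf (b_neq0 k)).
Qed.

(* The polar forms vanish together only if the line through [s] and [p] lies on
   the surface; [equal_nodes] then applies to the nodes [p i / s i]. *)
Lemma generic_polar_proportional (p : 'I_4 -> L) :
  \sum_i iota (b i) * s i ^+ 3 = 0 -> \sum_i iota (b i) * p i * s i ^+ 2 = 0 ->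
  \sum_i iota (b i) * p i ^+ 2 * s i = 0 -> \sum_i iota (b i) * p i ^+ 3 = 0 ->
  exists a, forall i, p i = a * s i.
Proof.
have s0 := generic_coord_neq0; move=> e0 e1 e2 e3.
pose w i := iota (b i) * s i ^+ 3; pose r i := p i / s i.
have pr i : p i = r i * s i by rewrite /r mulfVK.
exists (r ord0) => i; rewrite pr; congr (_ * _).
apply: (@equal_nodes_ord _ w r) => [j|j k|k].
- by rewrite mulf_neq0 ?fmorph_eq0 ?expf_neq0.
- exact: generic_pair_neq0.
case: k => [|[|[|[|k]]]] // _;
  [rewrite -[RHS]e0 | rewrite -[RHS]e1 | rewrite -[RHS]e2 | rewrite -[RHS]e3];
  by apply: eq_bigr => j _; rewrite ?(pr j) /w; ring.
Qed.

End GenericRelations.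

(** * The rational map attached to a curve on the surface *)

Definition ord1_3 : 'I_3 := @Ordinal 3 1 isT.
Definition ord2_3 : 'I_3 := @Ordinal 3 2 isT.

(** The degree is 3 whatever the degree of [q], so that the four coordinates of the curve remain
    homogeneous of one degree. *)
Definition homogenize3 (K : nzRingType) (q : {poly K}) : {mpoly K[3]} :=
  \sum_(j < 4) q`_j *: ('X_ord1_3 ^+ j * 'X_ord0 ^+ (3 - j)).

Lemma homogenize3_homog (K : nzRingType) (q : {poly K}) :
  homogenize3 q \is 3.-homog.
Proof.
apply: rpred_sum => j _; apply: rpredZ.
have X1 (i : 'I_3) : ('X_i : {mpoly K[3]}) \is 1.-homog by rewrite dhomogX /= mdeg1.
have := dhomogM (dhomogMn j (X1 ord1_3)) (dhomogMn (3 - j) (X1 ord0)).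
by rewrite !mul1n subnKC // -ltnS.
Qed.

Lemma mmap_homogenize3 (K L : comNzRingType) (iota : {rmorphism K -> L})
    (Y : 'I_3 -> L) (T : L) (q : {poly K}) :
  (size q <= 4)%N -> Y ord1_3 = T * Y ord0 ->
  mmap iota Y (homogenize3 q) = Y ord0 ^+ 3 * (map_poly iota q).[T].
Proof.
move=> q_le4 Y1; rewrite rmorph_sum.
rewrite (@horner_coef_wide _ 4); last by rewrite (leq_trans (size_poly _ _)).
rewrite mulr_sumr; apply: eq_bigr => j _ /=.
rewrite mmapZ rmorphM !rmorphXn /= !mmapX !mmap1U coef_map Y1 exprMn.
have -> : Y ord0 ^+ 3 = Y ord0 ^+ j * Y ord0 ^+ (3 - j).
  by rewrite -exprD subnKC // -ltnS.
by ring.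
Qed.

Section RmorphThirdPoint.
Variables (R S : comNzRingType) (phi : {rmorphism R -> S}).
Implicit Types b P w : 'I_4 -> R.

Lemma rmorph_quadric b P w :
  phi (\sum_j b j * P j * w j ^+ 2) = \sum_j phi (b j) * phi (P j) * phi (w j) ^+ 2.
Proof. by rewrite rmorph_sum; apply: eq_bigr => j _; rewrite !rmorphM expr2. Qed.

Lemma rmorph_third_point b P w i :
  phi (third_point b P w i) =
  third_point (fun j => phi (b j)) (fun j => phi (P j)) (fun j => phi (w j)) i.
Proof.
rewrite /third_point rmorphB !rmorphM rmorph_quadric rmorph_nat rmorph_sum.
congr (_ * _ - _); apply: eq_bigr => j _.
by rewrite rmorphM rmorphXn.
Qed.

Lemma rmorph_tangent_direction b P i1 i2 i3 y0 y2 i :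
  phi (tangent_direction b P i1 i2 i3 y0 y2 i) =
  tangent_direction (fun j => phi (b j)) (fun j => phi (P j)) i1 i2 i3
    (phi y0) (phi y2) i.
Proof.
rewrite /tangent_direction; do 3![case: ifP => _; first by
  rewrite ?rmorphN ?rmorphD !rmorphM ?rmorphXn].
exact: rmorph0.
Qed.

End RmorphThirdPoint.

Section Param.
Variables (K : fieldType) (b : 'I_4 -> K) (p : 'I_4 -> {poly K}).
Variables (i1 i2 i3 i4 : 'I_4).

Definition param_base (i : 'I_4) : {mpoly K[3]} := homogenize3 (p i).

(** ['X_ord0] is both the denominator of the parameter t of the curve and that of the slope v of the
    direction: the pair (t, v) is the point (1 : t : v) of the plane. *)
Definition param_dir : 'I_4 -> {mpoly K[3]} :=
  tangent_direction (fun j => (b j)%:MP) param_base i1 i2 i3 'X_ord0 'X_ord2_3.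

Definition param_quadric : {mpoly K[3]} :=
  \sum_j (b j)%:MP * param_base j * param_dir j ^+ 2.

Definition param : 4.-tuple {mpoly K[3]} :=
  [tuple third_point (fun j => (b j)%:MP) param_base param_dir i | i < 4].

Lemma tnth_param i :
  tnth param i = third_point (fun j => (b j)%:MP) param_base param_dir i.
Proof. by rewrite tnth_mktuple. Qed.

(** The base point has degree 3 and the direction 1 + 2 * 3 = 7, so the two terms of [third_point]
    have degrees 3 * 7 + 3 and (3 + 2 * 7) + 7. *)
Lemma param_homog i : tnth param i \is 24.-homog.
Proof.
have X1 (j : 'I_3) : ('X_j : {mpoly K[3]}) \is 1.-homog by rewrite dhomogX /= mdeg1.
have C0 c : (c%:MP : {mpoly K[3]}) \is 0.-homog.
  by rewrite -[c]mulr1 mpolyCM mul_mpolyC rpredZ // dhomog1.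
have base_h j : param_base j \is 3.-homog by exact: homogenize3_homog.
have l_h j : (b j)%:MP * param_base j ^+ 2 \is 6.-homog.
  by apply: (@dhomogM _ _ _ 0 _ 6); [exact: C0 | exact: (@dhomogMn _ _ _ 3)].
have yl_h y j : ('X_y : {mpoly K[3]}) * ((b j)%:MP * param_base j ^+ 2) \is 7.-homog.
  exact: (@dhomogM _ _ _ 1 _ 6).
have dir_h j : param_dir j \is 7.-homog.
  rewrite /param_dir /tangent_direction; do 2![case: ifP => _; first exact: yl_h].
  by case: ifP => _; [rewrite rpredN rpredD | exact: rpred0].
rewrite tnth_param /third_point rpredB //.
  apply: (@dhomogM _ _ _ 21 _ 3) => //; apply: rpred_sum => j _.
  by apply: (@dhomogM _ _ _ 0 _ 21); [exact: C0 | exact: (@dhomogMn _ _ _ 7)].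
apply: (@dhomogM _ _ _ 17 _ 7) => //.
apply: (@dhomogM _ _ _ 0 _ 17); first by rewrite -mpolyC1 -mpolyCMn.
apply: rpred_sum => j _; apply: (@dhomogM _ _ _ 3 _ 14); last exact: (@dhomogMn _ _ _ 7).
by apply: (@dhomogM _ _ _ 0 _ 3).
Qed.

End Param.

Lemma rmorph_homogenize3 (K M : fieldType) (phi : {rmorphism {mpoly K[3]} -> M})
    (q : {poly K}) : (size q <= 4)%N -> phi 'X_ord0 != 0 ->
  phi (homogenize3 q) =
  phi 'X_ord0 ^+ 3 * (map_poly (phi \o @mpolyC 3 K) q).[phi 'X_ord1_3 / phi 'X_ord0].
Proof.
move=> q_le4 X0; rewrite [LHS]rmorph_mpolyE.
pose t := phi 'X_ord1_3 / phi 'X_ord0.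
by rewrite (@mmap_homogenize3 _ _ (phi \o @mpolyC 3 K) _ t) ?mulfVK.
Qed.

Lemma horner_power_sum (K M : comNzRingType) (iota : {rmorphism K -> M}) (t : M)
    (n k : nat) (c : 'I_n -> K) (p : 'I_n -> {poly K}) :
  (map_poly iota (\sum_i c i *: p i ^+ k)).[t] =
  \sum_i iota (c i) * (map_poly iota (p i)).[t] ^+ k.
Proof.
rewrite rmorph_sum horner_sum; apply: eq_bigr => i _ /=.
by rewrite map_polyZ rmorphXn hornerZ horner_exp.
Qed.

Lemma mmap_homog_scale (K L : comNzRingType) (iota : {rmorphism K -> L}) (n d : nat)
    (s : 'I_n -> L) (m : L) (G : {mpoly K[n]}) : G \is d.-homog ->
  mmap iota (fun i => m * s i) G = m ^+ d * mmap iota s G.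
Proof.
move=> G_d; rewrite /mmap mulr_sumr !big_seq; apply: eq_bigr => M M_in.
rewrite mulrCA; congr (_ * _); rewrite /mmap1 -(dhomogP _ _ _ G_d M M_in) /= mdegE.
by rewrite -prodrXr -big_split; apply: eq_bigr => i _; rewrite exprMn.
Qed.

(** * Dominance of the map attached to a plane curve on the surface *)

Section CurveOnSurface.
Variables (K : fieldType) (b : 'I_4 -> K) (p : 'I_4 -> {poly K}) (lam : 'I_4 -> K).
Hypotheses (char3 : 3%N \notin [pchar K]) (b_neq0 : forall i, b i != 0).
Hypothesis p_le4 : forall i, (size (p i) <= 4)%N.
Hypothesis p_on : \sum_i b i *: p i ^+ 3 = 0.
Hypothesis p_plane : \sum_i lam i *: p i ^+ 1 = 0.
Hypothesis lam_neq0 : exists i, lam i != 0.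
Hypothesis p_nonconstant : exists i, (1 < size (p i))%N.
Hypothesis p_base_point_free : forall (L : fieldType) (iota : {rmorphism K -> L}) (t : L),
  exists i, (map_poly iota (p i)).[t] != 0.

Local Notation f := (diagonal_form b).

Lemma rmorph_param_base_on (M : fieldType) (phi : {rmorphism {mpoly K[3]} -> M}) :
  phi 'X_ord0 != 0 -> phi (\sum_i (b i)%:MP * param_base p i ^+ 3) = 0.
Proof.
move=> X0; pose t := phi 'X_ord1_3 / phi 'X_ord0.
pose iota : {rmorphism K -> M} := phi \o @mpolyC 3 K.
transitivity ((phi 'X_ord0 ^+ 3) ^+ 3 * (map_poly iota (\sum_i b i *: p i ^+ 3)).[t]).
  rewrite horner_power_sum mulr_sumr rmorph_sum; apply: eq_bigr => i _.
  rewrite rmorphM rmorphXn /param_base rmorph_homogenize3 // -/t -/iota exprMn.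
  by rewrite mulrCA.
by rewrite p_on rmorph0 horner0 mulr0.
Qed.

Lemma param_base_on : \sum_i (b i)%:MP * param_base p i ^+ 3 = 0.
Proof.
apply/eqP; rewrite -tofrac_eq0; apply/eqP; apply: rmorph_param_base_on.
by rewrite tofrac_eq0 -msupp_eq0 msuppX.
Qed.

(** A nonconstant [p k] gives [polar_poly] a nonzero coefficient in positive degree, hence a root in
    an extension. The point stays generic there because field morphisms are injective. *)
Lemma exists_curve_parameter :
  exists (L : fieldType) (iota : {rmorphism K -> L}) (s : 'I_4 -> L) (t : L),
    [/\ mmap iota s f = 0, forall d (G : {mpoly K[4]}), G \is d.-homog -> mmap iota s G = 0 ->
         vanishes_on f G
      & \sum_i iota (b i) * (map_poly iota (p i)).[t] ^+ 2 * s i = 0].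
Proof.
have [L [iota [s [sf gen_s]]]] := exists_generic_point char3 b_neq0.
have gen_s' d (G : {mpoly K[4]}) (_ : G \is d.-homog) := gen_s G.
pose h := polar_poly iota b s p.
have h_gt1 : (1 < size h)%N.
  have [k pk] := p_nonconstant; pose n := (size (p k ^+ 2)).-1.
  have pk0 : p k != 0 by rewrite -size_poly_gt0 ltnW.
  have n_gt0 : (0 < n)%N.
    by rewrite /n size_exp; move: pk; case: (size _) => [|[|m]].
  have hn : h`_n != 0 by exact: generic_polar_coef_neq0.
  rewrite ltnNge; apply/negP => h_le1; case/eqP: hn; apply: nth_default.
  exact: leq_trans h_le1 _.
have [L2 [kappa [t rt_t]]] := exists_root_in_extension h_gt1.
pose iota2 : {rmorphism K -> L2} := kappa \o iota.
have mmap_kappa G : mmap iota2 (kappa \o s) G = kappa (mmap iota s G).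
  pose psi : {rmorphism {mpoly K[4]} -> L2} := kappa \o mmap iota s.
  rewrite -[RHS]/(psi G) [RHS]rmorph_mpolyE; apply: mmap_ext => [c | i] /=.
    by rewrite mmapC.
  by rewrite mmapX mmap1U.
exists L2, iota2, (kappa \o s), t; split.
- by rewrite mmap_kappa sf rmorph0.
- by move=> d G G_d; rewrite mmap_kappa => /eqP; rewrite fmorph_eq0 => /eqP/gen_s.
have := eqP rt_t; rewrite /h /polar_poly rmorph_sum horner_sum => h_t.
rewrite -[RHS]h_t; apply: eq_bigr => i _ /=.
rewrite map_polyZ /= hornerZ -map_poly_comp rmorphM rmorphXn horner_exp /=.
by rewrite mulrAC.
Qed.

(** The indices are dictated by the preimage: [P i4 != 0] allows projection from P, [P i2 != 0]
    allows solving the tangent equation for the coordinate [i2], and [w i3 != 0] serves as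
    denominator of the direction. *)
Lemma exists_param_preimage :
  exists (i1 i2 i3 i4 : 'I_4) (L : fieldType) (iota : {rmorphism K -> L})
    (s : 'I_4 -> L) (Y : 'I_3 -> L) (m : L),
  [/\ uniq [:: i1; i2; i3; i4],
      forall d (G : {mpoly K[4]}), G \is d.-homog -> mmap iota s G = 0 ->
        vanishes_on f G,
      [/\ m != 0, mmap iota Y (param_base p i2) != 0,
       mmap iota Y (param_base p i4) != 0
       & mmap iota Y (param_quadric b p i1 i2 i3) != 0]
    & forall i, mmap iota Y (tnth (param b p i1 i2 i3) i) = m * s i].
Proof.
have [L [iota [s [t [sf gen_s h_t]]]]] := exists_curve_parameter.
pose P i := (map_poly iota (p i)).[t].
pose B i := iota (b i).
have B_neq0 i : B i != 0 by rewrite fmorph_eq0.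
have s_neq0 := generic_coord_neq0 b_neq0 gen_s.
have fs : \sum_i B i * s i ^+ 3 = 0 by rewrite -mmap_power_sum.
have fP : \sum_i B i * P i ^+ 3 = 0 by rewrite -horner_power_sum p_on rmorph0 horner0.
have lP : \sum_i iota (lam i) * P i ^+ 1 = 0.
  by rewrite -horner_power_sum p_plane rmorph0 horner0.
have [i4 P4] : exists i, P i != 0 by exact: p_base_point_free.
pose q := \sum_j B j * P j * s j ^+ 2.
have q_neq0 : q != 0.
  apply/eqP => q0; have [a Pa] := generic_polar_proportional b_neq0 gen_s fs q0 h_t fP.
  have a0 : a != 0 by apply: contraNneq P4 => a0; rewrite Pa a0 mul0r.
  have [k] := lam_neq0; rewrite (generic_linear_relation b_neq0 gen_s) ?eqxx //.
  apply: (mulfI a0); rewrite mulr0 -[RHS]lP mulr_sumr; apply: eq_bigr => i _.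
  by rewrite expr1 Pa mulrCA.
pose w i := P i4 * s i - s i4 * P i.
have sP : \sum_i B i * P i ^+ 2 * s i = 0 by exact: h_t.
have [lw wq wF] : [/\ \sum_i B i * P i ^+ 2 * w i = 0,
    \sum_i B i * P i * w i ^+ 2 = P i4 ^+ 2 * q
  & forall i, third_point B P w i = - 3%:R * P i4 ^+ 3 * q * s i].
  exact: third_point_direction.
(* If [P i4] were the only nonzero coordinate, the tangent equation at [s] would reduce to one
   nonzero term. *)
have [i2 /andP[n24 P2]] : exists i, (i != i4) && (P i != 0).
  apply: NNPP => noP; have : B i4 * P i4 ^+ 2 * s i4 != 0.
    by rewrite !mulf_neq0 ?expf_neq0.
  case/negP; apply/eqP; rewrite -[RHS]sP (bigD1 i4) //= big1 ?addr0 // => i ni.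
  have -> : P i = 0 by apply/eqP/negPn/negP => Pi; apply: noP; exists i; rewrite ni.
  by rewrite expr0n mulr0 mul0r.
have w4 : w i4 = 0 by rewrite /w mulrC subrr.
(* Otherwise only [w i2] could be nonzero, and the tangent equation kills it; but [w = 0]
   contradicts [wq], where [q != 0]. *)
have [i3 /and3P[n32 n34 w3]] : exists i, [&& i != i2, i != i4 & w i != 0].
  apply: NNPP => now; have w0 i : i != i2 -> w i = 0.
    have [->//|ni4 ni2] := eqVneq i i4; apply/eqP/negPn/negP => wi.
    by apply: now; exists i; rewrite ni2 ni4.
  have w2 : w i2 = 0.
    have l2 : B i2 * P i2 ^+ 2 != 0 by rewrite mulf_neq0 ?expf_neq0.
    apply: (mulfI l2); rewrite mulr0 -[RHS]lw (bigD1 i2) //= big1 ?addr0 // => i ni.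
    by rewrite w0 // mulr0.
  have : P i4 ^+ 2 * q != 0 by rewrite mulf_neq0 ?expf_neq0.
  rewrite -wq big1 ?eqxx // => i _; have [->|/w0->] := eqVneq i i2.
    by rewrite w2 expr0n mulr0.
  by rewrite expr0n mulr0.
have [i1 uniq_i] : exists i1, uniq [:: i1; i2; i3; i4].
  by apply: exists_fourth_index; rewrite /= !inE negb_or n24 n34 eq_sym n32.
(* The point (1 : t : w i1 / w i3), with the denominator cleared. *)
pose Y (j : 'I_3) : L :=
  if j == ord0 then w i3 else if j == ord1_3 then t * w i3 else w i1.
(* The factors by which the homogenised base point and direction at [Y] differ from [P] and [w]. *)
pose A := w i3 ^+ 3; pose u := A ^+ 2 * (B i2 * P i2 ^+ 2).
have A_neq0 : A != 0 by rewrite expf_neq0.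
have u_neq0 : u != 0 by rewrite !mulf_neq0 ?expf_neq0.
have baseY i : mmap iota Y (param_base p i) = A * P i by rewrite (@mmap_homogenize3 _ _ _ _ t).
have dirY i : mmap iota Y (param_dir b p i1 i2 i3 i) = u * w i.
  rewrite /param_dir rmorph_tangent_direction /= !mmapX !mmap1U.
  rewrite /tangent_direction !baseY !mmapC -!/(B _) /Y /=.
  case: eqP => [->|n1]; first by rewrite /u; ring.
  case: eqP => [->|n3]; first by rewrite /u; ring.
  case: eqP => [->|n2].
    move: lw; rewrite (big_uniq4 _ uniq_i) w4 mulr0 addr0 => lw2.
    rewrite /u; transitivity (- A ^+ 2 * (B i1 * P i1 ^+ 2 * w i1
      + (B i2 * P i2 ^+ 2 * w i2 + B i3 * P i3 ^+ 2 * w i3))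
      + A ^+ 2 * (B i2 * P i2 ^+ 2) * w i2); first by ring.
    by rewrite lw2; ring.
  have -> : i = i4.
    have := mem_uniq_ord i uniq_i erefl; rewrite !inE.
    by case/or4P=> /eqP.
  by rewrite w4 mulr0.
pose m := A * u ^+ 3 * (- 3%:R * P i4 ^+ 3 * q).
have three_neq0 : 3%:R != 0 :> L.
  by rewrite -(rmorph_nat iota) fmorph_eq0; move: char3; rewrite inE.
exists i1, i2, i3, i4, L, iota, s, Y, m; split=> //.
  split; rewrite ?baseY ?mulf_neq0 ?oppr_eq0 ?expf_neq0 //.
  rewrite /param_quadric rmorph_quadric /=.
  rewrite (eq_bigr (fun j => A * u ^+ 2 * (B j * P j * w j ^+ 2))).
    by rewrite -mulr_sumr wq !mulf_neq0 ?expf_neq0.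
  by move=> j _; rewrite mmapC baseY dirY; rewrite -/(B j); ring.
move=> i; rewrite tnth_param rmorph_third_point /=.
transitivity (third_point B (fun j => A * P j) (fun j => u * w j) i).
  rewrite /third_point !baseY !dirY; congr (_ * _ - _ * _ * _); apply: eq_bigr => j _;
    by rewrite mmapC ?baseY dirY.
by rewrite third_point_scale wF /m mulrA.
Qed.

(** At [Y], a form G of degree d killed by the map gives [m ^+ d] times its value at [s]; so G
    vanishes at the generic point. The polynomials claimed nonzero are so at [Y]. *)
Lemma exists_dominant_param :
  exists i1 i2 i3 i4 : 'I_4,
  [/\ uniq [:: i1; i2; i3; i4], dominant f (param b p i1 i2 i3),
      param_base p i2 != 0, param_base p i4 != 0 & param_quadric b p i1 i2 i3 != 0].
Proof.
have [i1 [i2 [i3 [i4 [L [iota [s [Y [m [uniq_i gen_s [m0 P2 P4 q0] FY]]]]]]]]]] :=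
  exists_param_preimage.
have nz (r : {mpoly K[3]}) : mmap iota Y r != 0 -> r != 0.
  by apply: contraNneq => ->; rewrite mmap0.
exists i1, i2, i3, i4; split; rewrite ?nz // => d G G_d GF.
apply: (gen_s d) => //; have := congr1 (mmap iota Y) GF.
rewrite mmap_comp_mpoly mmap0 (@mmap_ext _ _ _ iota iota _ (fun i => m * s i)) //.
rewrite (mmap_homog_scale _ _ _ G_d) => /eqP; rewrite mulf_eq0 expf_eq0 (negPf m0) andbF.
by move/eqP.
Qed.

End CurveOnSurface.

(** * The degree *)

Lemma in_subfield_mmap (K M : fieldType) (D : subfield_pred M)
    (iota : {rmorphism K -> M}) n (y : 'I_n -> M) (G : {mpoly K[n]}) :
  (forall c, D (iota c)) -> (forall i, D (y i)) -> D (mmap iota y G).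
Proof.
move=> D_iota D_y; apply: in_subfield_sum => m _; apply: in_subfieldM => //.
by apply: in_subfield_prod => i _; apply: in_subfieldX.
Qed.

Lemma in_subfield_horner (K M : fieldType) (D : subfield_pred M)
    (iota : {rmorphism K -> M}) (t : M) (q : {poly K}) :
  (forall c, D (iota c)) -> D t -> D (map_poly iota q).[t].
Proof.
move=> D_iota D_t; rewrite horner_coef; apply: in_subfield_sum => i _.
by apply: in_subfieldM; [rewrite coef_map; exact: D_iota | exact: in_subfieldX].
Qed.

Lemma extension_degree_ext (M : fieldType) (E E' L L' : M -> Prop) k :
  (forall u, E u <-> E' u) -> (forall u, L u <-> L' u) ->
  extension_degree E L k -> extension_degree E' L' k.
Proof.
move=> EE' LL' [c [L_c L_span c_free]]; exists c; split=> [i|u /LL'/L_span[a Ea ->]|a Ea].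
- exact/LL'.
- by exists a => // i; apply/EE'.
by apply: c_free => i; apply/EE'.
Qed.

Section FunctionFields.
Variables (K M : fieldType) (n m : nat) (phi : {rmorphism {mpoly K[n]} -> M}).
Variables (F : m.-tuple {mpoly K[n]}).
Hypothesis phi_inj : injective phi.

Definition homog_fraction (u : M) : Prop :=
  exists (d : nat) (G H : {mpoly K[n]}),
    [/\ G \is d.-homog, H \is d.-homog, H != 0 & u = phi G / phi H].

(** The denominator is tested after composition with [F], instead of by [~ vanishes_on f H]; closure
    under products is then immediate in the domain of polynomials. *)
Definition homog_fraction_at (u : M) : Prop :=
  exists (d : nat) (G H : {mpoly K[m]}),
    [/\ G \is d.-homog, H \is d.-homog, H \mPo F != 0
      & u = phi (G \mPo F) / phi (H \mPo F)].

Let phi_neq0 r : r != 0 -> phi r != 0.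
Proof. by rewrite raddf_eq0. Qed.

Lemma homog_fraction_at_const c : homog_fraction_at (phi c%:MP).
Proof.
exists 0%N, c%:MP, 1; split.
- by rewrite -[c]mulr1 mpolyCM mul_mpolyC rpredZ // dhomog1.
- exact: dhomog1.
- by rewrite rmorph1 oner_neq0.
by rewrite !rmorph1 comp_mpolyC divr1.
Qed.

Lemma homog_fraction_at1 : homog_fraction_at 1.
Proof. by have := homog_fraction_at_const 1; rewrite mpolyC1 rmorph1. Qed.

Lemma homog_fraction_atB x y :
  homog_fraction_at x -> homog_fraction_at y -> homog_fraction_at (x - y).
Proof.
move=> [d1 [G1 [H1 [hG1 hH1 H1_neq0 ->]]]] [d2 [G2 [H2 [hG2 hH2 H2_neq0 ->]]]].
exists (d1 + d2)%N, (G1 * H2 - G2 * H1), (H1 * H2); split.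
- by rewrite rpredB ?(dhomogM hG1 hH2) // addnC (dhomogM hG2 hH1).
- exact: dhomogM.
- by rewrite rmorphM mulf_neq0.
have P1 := phi_neq0 H1_neq0; have P2 := phi_neq0 H2_neq0.
rewrite rmorphB !rmorphM /= rmorphB !rmorphM /= -[in LHS]mulNr addf_div //.
by rewrite mulNr.
Qed.

Lemma homog_fraction_at_div x y :
  homog_fraction_at x -> homog_fraction_at y -> homog_fraction_at (x / y).
Proof.
move=> [d1 [G1 [H1 [hG1 hH1 H1_neq0 ->]]]] [d2 [G2 [H2 [hG2 hH2 H2_neq0 ->]]]].
have [G20|G2_neq0] := eqVneq (G2 \mPo F) 0.
  rewrite G20 rmorph0 mul0r invr0 mulr0 -(rmorph0 phi) -mpolyC0.
  exact: homog_fraction_at_const.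
exists (d1 + d2)%N, (G1 * H2), (H1 * G2); split; rewrite ?dhomogM //.
  by rewrite rmorphM mulf_neq0.
have P1 := phi_neq0 H1_neq0; have P2 := phi_neq0 H2_neq0.
by rewrite !rmorphM /= ?rmorphM /= invf_div mulf_div.
Qed.

Definition homog_fraction_subfield :=
  SubfieldPred homog_fraction_at1 homog_fraction_atB homog_fraction_at_div.

End FunctionFields.

Section Degree.
Variables (K M : fieldType) (phi : {rmorphism {mpoly K[3]} -> M}).
Variables (b : 'I_4 -> K) (p : 'I_4 -> {poly K}) (i1 i2 i3 i4 : 'I_4).
Hypotheses (phi_inj : injective phi) (char3 : 3%N \notin [pchar K]).
Hypotheses (b_neq0 : forall i, b i != 0) (p_le4 : forall i, (size (p i) <= 4)%N).
Hypotheses (uniq_i : uniq [:: i1; i2; i3; i4]).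
Hypothesis p_on : \sum_i b i *: p i ^+ 3 = 0.

Local Notation f := (diagonal_form b).
Local Notation F := (param b p i1 i2 i3).

Hypotheses (dom_F : dominant f F) (P2 : param_base p i2 != 0)
  (P4 : param_base p i4 != 0) (q_neq0 : param_quadric b p i1 i2 i3 != 0).

Let iota : {rmorphism K -> M} := phi \o @mpolyC 3 K.
Let x0 := phi 'X_ord0.
Let t := phi 'X_ord1_3 / x0.
Let v := phi 'X_ord2_3 / x0.
Let s i := phi (tnth F i).
Let pt i := (map_poly iota (p i)).[t].

Let phi_neq0 r : r != 0 -> phi r != 0.
Proof. by rewrite raddf_eq0. Qed.

Let x0_neq0 : x0 != 0.
Proof. by apply: phi_neq0; rewrite -msupp_eq0 msuppX. Qed.

Let phi_comp G : phi (G \mPo F) = mmap iota s G.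
Proof.
pose psi : {rmorphism {mpoly K[4]} -> M} := phi \o comp_mpoly F.
rewrite -[LHS]/(psi G) [LHS]rmorph_mpolyE; apply: mmap_ext => [c | i] /=.
  by rewrite comp_mpolyC.
by rewrite comp_mpolyXU -tnth_nth.
Qed.

(** By dominance the coordinates of the map form a generic point themselves, now in [M], so the
    generic relations apply to them. *)
Lemma param_generic d (G : {mpoly K[4]}) :
  G \is d.-homog -> mmap iota s G = 0 -> vanishes_on f G.
Proof.
move=> G_d; rewrite -phi_comp => /eqP GF; apply: dom_F G_d _.
by apply: phi_inj; rewrite rmorph0; apply/eqP.
Qed.

Let s_neq0 i : s i != 0.
Proof. exact: generic_coord_neq0 b_neq0 param_generic i. Qed.

Let phi_base i : phi (param_base p i) = x0 ^+ 3 * pt i.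
Proof. by rewrite /param_base rmorph_homogenize3 // x0_neq0. Qed.

Let uniq_i_neq : [/\ i2 != i1, i3 != i1, i2 != i3, i4 != i1 & (i4 != i2) && (i4 != i3)].
Proof.
move: uniq_i; rewrite /= !inE !negb_or -!andbA.
case/and4P=> n12 n13 n14 /and4P[n23 n24 n34 _].
by rewrite ![i4 == _]eq_sym ![_ == i1]eq_sym n12 n13 n14 n23 n24 n34.
Qed.

(* Projecting from the base point kills it, and leaves the direction. *)
Lemma direction_recovered :
  (s i1 / s i4 * pt i4 - pt i1) / (s i3 / s i4 * pt i4 - pt i3) = v.
Proof.
pose w := param_dir b p i1 i2 i3.
have [n21 n31 n23 n41 /andP[n42 n43]] := uniq_i_neq.
have w4 : w i4 = 0.
  by rewrite /w /param_dir /tangent_direction (negPf n41) (negPf n43) (negPf n42).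
have w1 : w i1 = 'X_ord2_3 * ((b i2)%:MP * param_base p i2 ^+ 2).
  by rewrite /w /param_dir /tangent_direction eqxx.
have w3 : w i3 = 'X_ord0 * ((b i2)%:MP * param_base p i2 ^+ 2).
  by rewrite /w /param_dir /tangent_direction (negPf n31) eqxx.
pose l2 := phi ((b i2)%:MP * param_base p i2 ^+ 2).
have l2_neq0 : l2 != 0.
  by rewrite phi_neq0 // mulf_neq0 ?mpolyC_eq0 ?expf_neq0.
have x0n := x0_neq0; have s4 := s_neq0 i4.
pose k := - 3%:R * phi (param_quadric b p i1 i2 i3) * pt i4 / s i4.
have pt4 : pt i4 != 0.
  by have := phi_neq0 P4; rewrite phi_base mulf_eq0 negb_or => /andP[].
have k_neq0 : k != 0.
  rewrite mulf_neq0 ?invr_eq0 ?s4 // mulf_neq0 ?pt4 // mulf_neq0 ?phi_neq0 //.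
  rewrite oppr_eq0.
  by rewrite -(rmorph_nat iota) fmorph_eq0; move: char3; rewrite inE.
have sE i : s i = phi (\sum_j (b j)%:MP * w j ^+ 3) * (x0 ^+ 3 * pt i)
    - 3%:R * phi (param_quadric b p i1 i2 i3) * phi (w i).
  by rewrite /s tnth_param /third_point rmorphB !rmorphM rmorph_nat phi_base.
have proj i : s i / s i4 * pt i4 - pt i = k * phi (w i).
  apply: (mulIf s4); rewrite mulrBl.
  have -> : s i / s i4 * pt i4 * s i4 = s i * pt i4 by rewrite mulrAC mulfVK.
  have -> : k * phi (w i) * s i4 =
      - 3%:R * phi (param_quadric b p i1 i2 i3) * pt i4 * phi (w i).
    by rewrite mulrAC /k mulfVK.
  by rewrite (sE i) (sE i4) w4 rmorph0; ring.
have phi1 : phi (w i1) = phi 'X_ord2_3 * l2 by rewrite w1 rmorphM.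
have phi3 : phi (w i3) = x0 * l2 by rewrite w3 rmorphM.
by rewrite !proj phi1 phi3 -mulf_div divff // mul1r -mulf_div divff // mulr1.
Qed.

Lemma param_has_degree_le6 :
  exists2 k, (k <= 6)%N & extension_degree (homog_fraction_at phi F) (homog_fraction phi) k.
Proof.
have x0n := x0_neq0.
pose E : subfield_pred M := homog_fraction_subfield F phi_inj.
have E_s i : E (s i / s i4).
  exists 1%N, 'X_i, 'X_i4; rewrite !dhomogX /= !mdeg1 !comp_mpolyXU -!tnth_nth; split=> //.
  by apply: contra_neq (s_neq0 i4) => F0; rewrite /s F0 rmorph0.
have E_K c : E (iota c) by exact: homog_fraction_at_const.
pose h := polar_poly iota b s p.
have s4 := s_neq0 i4.
have h_neq0 : h != 0.
  have p2 : p i2 != 0.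
    apply: contraNneq P2 => p0; rewrite /param_base /homogenize3 p0.
    by rewrite big1 // => j _; rewrite coef0 scale0r.
  apply: contraNneq (generic_polar_coef_neq0 b_neq0 param_generic p2) => h0.
  by rewrite -/h h0 coef0.
(* Degree 6 plus one: each [p i] has degree at most 3 and is squared. *)
have sz_h : (size h <= 7)%N.
  apply: (leq_trans (size_sum _ _ _)); apply/bigmax_leqP => i _.
  apply: (leq_trans (size_scale_leq _ _)); apply: (leq_trans (size_poly _ _)).
  apply: (leq_trans (size_exp_leq _ _)); have := p_le4 i; lia.
(* The coefficients of [h] are linear in [s]; division by [s i4] brings them into the pulled-back
   field. *)
apply: (@extension_degree_le _ E (homog_fraction phi) t ((s i4)^-1 *: h)).
- by rewrite scaler_eq0 negb_or invr_eq0 s4.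
- exact: leq_trans (size_scale_leq _ _) sz_h.
- move=> n; rewrite coefZ coef_polar_poly mulr_sumr; apply: in_subfield_sum => i _.
  by rewrite mulrCA [_^-1 * _]mulrC; apply: in_subfieldM.
- rewrite /root hornerZ mulf_eq0 invr_eq0 (negPf s4) /= horner_polar_poly.
  (* The factor [x0 ^+ 6] turns the squares of [pt i] into those of the homogeneous base point. *)
  apply/eqP/(mulfI (expf_neq0 6 x0n)); rewrite mulr0.
  have tan : \sum_i (b i)%:MP * param_base p i ^+ 2 * tnth F i = 0.
    under eq_bigr do rewrite tnth_param.
    apply: third_point_tangent; first exact: param_base_on.
    exact: tangent_directionP uniq_i.
  rewrite -[RHS](rmorph0 phi) -[in RHS]tan [RHS]rmorph_sum [LHS]mulr_sumr.
  apply: eq_bigr => i _.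
  by rewrite 2!rmorphM rmorphXn phi_base /= -/(s i) -/(pt i); ring.
- move=> i; exists i, ('X_ord1_3 ^+ i), ('X_ord0 ^+ i).
  have X1 (j : 'I_3) : ('X_j : {mpoly K[3]}) \is 1.-homog by rewrite dhomogX /= mdeg1.
  have Xi (j : 'I_3) : ('X_j : {mpoly K[3]}) ^+ i \is i.-homog.
    by have := dhomogMn i (X1 j); rewrite mul1n.
  rewrite !Xi expf_neq0 -?msupp_eq0 ?msuppX //; split=> //.
  by rewrite !rmorphXn expr_div_n.
move=> D ED D_t u [d [G [H [G_d H_d H_neq0 ->]]]].
have D_K c : D (iota c) by apply/ED/E_K.
have D_pt i : D (pt i) by exact: in_subfield_horner.
have D_v : D v.
  rewrite -direction_recovered.
  by apply: in_subfield_div; apply: in_subfieldB => //; apply: in_subfieldM => //; apply: ED.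
(* Dehomogenisation: a quotient of forms of equal degree is a rational expression in [t] and [v]. *)
pose y (j : 'I_3) := if j == ord0 then 1 else if j == ord1_3 then t else v.
have phiE r e : r \is e.-homog -> phi r = x0 ^+ e * mmap iota y r.
  move=> r_e; rewrite -(mmap_homog_scale _ _ _ r_e) [LHS]rmorph_mpolyE.
  apply: mmap_ext => // j; rewrite /y; have [->|n0] := eqVneq j ord0.
    by rewrite mulr1.
  have [->|n1] := eqVneq j ord1_3; first by rewrite mulrC mulfVK.
  rewrite mulrC mulfVK //; congr (phi 'X__); apply: val_inj => /=.
  by case: j n0 n1 => [[|[|[|?]]]].
rewrite (phiE _ _ G_d) (phiE _ _ H_d) -mulf_div divff ?expf_neq0 // mul1r.
apply: in_subfield_div; apply: in_subfield_mmap => // j; rewrite /y;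
  (case: ifP => _; first exact: in_subfield1); by case: ifP.
Qed.

End Degree.

(** * The tangent section at (1 : 1 : 1 : 1) *)

Section SmoothDiagonal.
Variables (K : fieldType) (a1 a2 a3 : K).

Definition diagonal_coef (i : 'I_4) : K := nth 0 [:: a1; a2; a3; - (a1 + a2 + a3)] i.

Lemma diagonal_cubicE : diagonal_cubic a1 a2 a3 = diagonal_form diagonal_coef.
Proof.
rewrite /diagonal_form !big_ord_recl big_ord0 /diagonal_coef /=.
rewrite /diagonal_cubic.
have E (i j : 'I_4) : val i = val j -> 'X_i = 'X_j :> {mpoly K[4]} by move/val_inj->.
rewrite (E 0 ord0) // (E 1 (lift ord0 ord0)) //.
rewrite (E 2%:R (lift ord0 (lift ord0 ord0))) //.
rewrite (E 3%:R (lift ord0 (lift ord0 (lift ord0 ord0)))) //.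
by rewrite -!mul_mpolyC !mpolyCN !mpolyCD; ring.
Qed.

(** If the k-th coefficient were 0, the k-th coordinate point would be singular. *)
Lemma smooth_diagonal_coef_neq0 : smooth_hypersurface (diagonal_cubic a1 a2 a3) ->
  forall i, diagonal_coef i != 0.
Proof.
rewrite diagonal_cubicE => smooth k; apply/eqP => bk0.
pose x (i : 'I_4) : K := (i == k)%:R.
have x0 i n : (0 < n)%N -> diagonal_coef i * x i ^+ n = 0.
  rewrite /x; have [->|_] := eqVneq i k; first by rewrite bk0 mul0r.
  by case: n => // n _; rewrite expr0n mulr0.
have idE r : map_mpoly (idfun : K -> K) r = r :> {mpoly K[4]}.
  by rewrite -[RHS]/(idfun r) [RHS](rmorph_mpolyE idfun).
suff : x k = 0 by rewrite /x eqxx => /eqP; rewrite oner_eq0.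
apply: (smooth K idfun) => [|j]; rewrite idE.
  rewrite rmorph_sum big1 // => i _ /=.
  by rewrite mevalZ rmorphXn /= mevalXU x0.
rewrite (raddf_sum (mderiv j)) rmorph_sum big1 // => i _ /=.
rewrite mderivZ mpolyXn mderivX !mevalZ mulmnE mnm1E.
have [->|_] := eqVneq i j; last by rewrite mul0n mul0r mulr0.
have -> : (U_(j) *+ 3 - U_(j) = U_(j) *+ 2)%MM by rewrite mulmSr addmK.
by rewrite -mpolyXn rmorphXn /= mevalXU mulrCA x0 // mulr0.
Qed.

Hypotheses (char2 : 2%N \notin [pchar K]) (char3 : 3%N \notin [pchar K]).
Hypothesis coef_neq0 : forall i, diagonal_coef i != 0.

(** Tangent directions with last coordinate 0 satisfy a1 v1 + a2 v2 + a3 v3 = 0; this is the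
    solution with v2 : v3 = 1 : X. *)
Let v1 : {poly K} := - (a2%:P + a3%:P * 'X).
Let v2 : {poly K} := a1%:P.
Let v3 : {poly K} := a1%:P * 'X.
Let q : {poly K} := a1%:P * v1 ^+ 2 + a2%:P * v2 ^+ 2 + a3%:P * v3 ^+ 2.
Let c : {poly K} := a1%:P * v1 ^+ 3 + a2%:P * v2 ^+ 3 + a3%:P * v3 ^+ 3.
Let g : {poly K} := gcdp c q.
Let c' : {poly K} := c %/ g.
Let q' : {poly K} := q %/ g.

(* The section of the surface by its tangent plane at (1 : 1 : 1 : 1) is
   parametrised by the directions (v1, v2, v3) of that plane: the point is
   (c - 3 q v1 : c - 3 q v2 : c - 3 q v3 : c), where q and c are the quadratic and
   cubic terms of the equation at (1 : 1 : 1 : 1). If that point is on a line of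
   the surface, c and q have common factors, which are removed here. *)
Definition tangent_section (i : 'I_4) : {poly K} :=
  nth 0 [:: c' - 3%:R * q' * v1; c' - 3%:R * q' * v2; c' - 3%:R * q' * v3; c'] i.

Let a1_neq0 : a1 != 0. Proof. exact: coef_neq0 (@Ordinal 4 0 isT). Qed.
Let a2_neq0 : a2 != 0. Proof. exact: coef_neq0 (@Ordinal 4 1 isT). Qed.
Let a3_neq0 : a3 != 0. Proof. exact: coef_neq0 (@Ordinal 4 2 isT). Qed.

Let qE : q = \poly_(i < 3) [:: a1 * a2 ^+ 2 + a2 * a1 ^+ 2; 2%:R * a1 * a2 * a3;
  a1 * a3 ^+ 2 + a3 * a1 ^+ 2]`_i.
Proof.
rewrite poly_def !big_ord_recl big_ord0 /= -!mul_polyC !polyCD !polyCM.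
by rewrite /q /v1 /v2 /v3 ?polyC_natr; ring.
Qed.

Let cE : c = \poly_(i < 4) [:: a2 * a1 ^+ 3 - a1 * a2 ^+ 3; - 3%:R * a1 * a2 ^+ 2 * a3;
  - 3%:R * a1 * a2 * a3 ^+ 2; a3 * a1 ^+ 3 - a1 * a3 ^+ 3]`_i.
Proof.
rewrite poly_def !big_ord_recl big_ord0 /= -!mul_polyC !polyCD !polyCN !polyCM.
by rewrite /c /v1 /v2 /v3 ?polyC_natr; ring.
Qed.

Let q_neq0 : q != 0.
Proof.
(* The coefficient 2 a1 a2 a3 is nonzero as the characteristic is not 2. *)
apply/eqP => /(congr1 (fun r : {poly K} => r`_1)).
rewrite qE coef_poly coef0 /=; apply/eqP.
rewrite !mulf_neq0 ?a1_neq0 ?a2_neq0 ?a3_neq0 //.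
Qed.

Let g_neq0 : g != 0. Proof. by rewrite gcdp_eq0 negb_and q_neq0 orbT. Qed.

Let c'g : c = c' * g. Proof. by rewrite divpK ?dvdp_gcdl. Qed.
Let q'g : q = q' * g. Proof. by rewrite divpK ?dvdp_gcdr. Qed.

Let q'_neq0 : q' != 0.
Proof. by apply: contraNneq q_neq0 => q'0; rewrite q'g q'0 mul0r. Qed.

Let size_c' : (size c' <= 4)%N.
Proof.
by rewrite (leq_trans (leq_divp _ _)) // cE size_poly.
Qed.

Let size_q' : (size q' <= 3)%N.
Proof.
by rewrite (leq_trans (leq_divp _ _)) // qE size_poly.
Qed.

(** Division by [g] preserves the ratio of c to q, which is all that the residual point depends
    on. *)
Lemma tangent_section_on : \sum_i diagonal_coef i *: tangent_section i ^+ 3 = 0.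
Proof.
rewrite !big_ord_recl big_ord0 /diagonal_coef /tangent_section /= -!mul_polyC.
have cq : c' * q = q' * c by rewrite c'g q'g mulrCA.
rewrite !polyCN !polyCD.
transitivity (27%:R * q' ^+ 2 * (c' * q - q' * c)); last by rewrite cq subrr mulr0.
rewrite /q /c; move: c' q'; rewrite /v1 /v2 /v3 => C Q; ring.
Qed.

(** The tangent plane at (1 : 1 : 1 : 1) has the same coefficients as the cubic. *)
Lemma tangent_section_plane :
  \sum_i diagonal_coef i *: tangent_section i ^+ 1 = 0.
Proof.
rewrite !big_ord_recl big_ord0 /diagonal_coef /tangent_section /= -!mul_polyC.
by rewrite !polyCN !polyCD; move: c' q'; rewrite /v1 /v2 /v3 => C Q; ring.
Qed.

Lemma size_tangent_section i : (size (tangent_section i) <= 4)%N.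
Proof.
have qv (w : {poly K}) : (size w <= 2)%N -> (size (c' - 3%:R * q' * w)%R <= 4)%N.
  move=> w_le2; rewrite (leq_trans (size_polyD _ _)) // geq_max size_c' size_polyN.
  have -> : 3%:R * q' * w = 3%:R *: (q' * w) by rewrite -mul_polyC polyC_natr mulrA.
  rewrite (leq_trans (size_scale_leq _ _)) // (leq_trans (size_polyMleq _ _)) //.
  by rewrite -subn1 leq_subLR (leq_add size_q' w_le2).
have sz_lin (x y : K) : (size (x%:P + y%:P * 'X)%R <= 2)%N.
  by rewrite (leq_trans (size_polyD _ _)) // geq_max size_polyC mul_polyC
    (leq_trans (size_scale_leq _ _)) ?size_polyX //; case: (x != 0).
case: i => [[|[|[|[|//]]]] lt_i]; rewrite /tangent_section /=.
- by rewrite qv // /v1 size_polyN.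
- by rewrite qv // /v2 size_polyC; case: (a1 != 0).
- by have := sz_lin 0 a1; rewrite polyC0 add0r => ?; rewrite qv.
- exact: size_c'.
Qed.

Let three_neq0 : 3%:R != 0 :> K.
Proof. by move: char3; rewrite inE. Qed.

(** The last two coordinates differ by 3 a1 q' X, which is not constant. *)
Lemma tangent_section_nonconstant : exists i, (1 < size (tangent_section i))%N.
Proof.
apply: NNPP => no_i.
have le1 i : (size (tangent_section i) <= 1)%N.
  by rewrite leqNgt; apply/negP => gt1; apply: no_i; exists i.
have := le1 (@Ordinal 4 3 isT); have := le1 (@Ordinal 4 2 isT).
rewrite /tangent_section /= => s3 s4.
have : (size (q' * 'X)%R <= 1)%N.
  have -> : q' * 'X = (3%:R * a1)^-1 *: (c' - (c' - 3%:R * q' * v3)).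
    rewrite opprB addrCA subrr addr0 -mul_polyC /v3.
    have e : (3%:R * a1)^-1%:P * (3%:R * a1%:P) = 1 :> {poly K}.
      by rewrite -polyC1 -polyCMn -!polyCM mulVf // mulf_neq0 ?three_neq0 ?a1_neq0.
    by transitivity ((3%:R * a1)^-1%:P * (3%:R * a1%:P) * (q' * 'X)); [rewrite e mul1r | ring].
  rewrite (leq_trans (size_scale_leq _ _)) // (leq_trans (size_polyD _ _)) //.
  by rewrite geq_max s4 size_polyN s3.
by rewrite size_mulX ?q'_neq0 // ltnS leqn0 size_poly_eq0 (negPf q'_neq0).
Qed.

(** As [v2] is a nonzero constant, a common zero of the second and fourth coordinates is a common
    root of the coprime [c'] and [q']. *)
Lemma tangent_section_base_point_free (L : fieldType) (iota : {rmorphism K -> L}) (t : L) :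
  exists i, (map_poly iota (tangent_section i)).[t] != 0.
Proof.
apply: NNPP => no_i.
have all0 i : (map_poly iota (tangent_section i)).[t] = 0.
  by apply/eqP/negPn/negP => n0; apply: no_i; exists i.
have := all0 (@Ordinal 4 3 isT); have := all0 (@Ordinal 4 1 isT).
rewrite /tangent_section /= => p2 c0.
have q0 : (map_poly iota q').[t] = 0.
  have := p2; rewrite rmorphB !rmorphM rmorph_nat /= map_polyC hornerD hornerN !hornerM c0.
  rewrite add0r -polyC_natr !hornerC => /eqP; rewrite oppr_eq0 !mulf_eq0 fmorph_eq0.
  rewrite (negPf a1_neq0) orbF -(rmorph_nat iota) fmorph_eq0.
  by rewrite (negPf three_neq0) => /eqP.
have /Bezout_eq1_coprimepP[[u w] /= uw] : coprimep c' q'.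
  by apply: coprimep_div_gcd; rewrite q_neq0 orbT.
have := congr1 (fun r => (map_poly iota r).[t]) uw.
rewrite rmorphD !rmorphM !hornerE /= c0 q0 !mulr0 addr0 rmorph1 hornerC => /eqP.
by rewrite eq_sym oner_eq0.
Qed.

End SmoothDiagonal.

Lemma comp_diagonal_form (K : fieldType) (b : 'I_4 -> K) (n : nat)
    (F : 4.-tuple {mpoly K[n]}) :
  diagonal_form b \mPo F = \sum_i (b i)%:MP * tnth F i ^+ 3.
Proof.
rewrite [LHS]raddf_sum; apply: eq_bigr => i _ /=.
by rewrite comp_mpolyZ rmorphXn /= comp_mpolyXU -tnth_nth mul_mpolyC.
Qed.

Theorem theorem3p4 (K : fieldType) (char2 : 2%N \notin [pchar K])
    (char3 : 3%N \notin [pchar K]) (omega : K)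
    (homega : 3.-primitive_root omega) (a1 a2 a3 : K)
    (smoothS : smooth_hypersurface (diagonal_cubic a1 a2 a3)) :
  exists F : 4.-tuple {mpoly K[3]},
    [/\ is_rational_map (diagonal_cubic a1 a2 a3) F,
        dominant (diagonal_cubic a1 a2 a3) F
      & exists2 k : nat, (k <= 6)%N & has_degree (diagonal_cubic a1 a2 a3) F k].
Proof.
have b_neq0 := smooth_diagonal_coef_neq0 smoothS.
rewrite diagonal_cubicE.
set b := diagonal_coef a1 a2 a3 in b_neq0 *; set f := diagonal_form b.
pose p := tangent_section a1 a2 a3.
have p_le4 i : (size (p i) <= 4)%N by exact: size_tangent_section.
have p_on : \sum_i b i *: p i ^+ 3 = 0 by exact: tangent_section_on.
have [i1 [i2 [i3 [i4 [uniq_i dom_F P2 P4 q0]]]]] :=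
  exists_dominant_param char3 b_neq0 p_le4 p_on (tangent_section_plane a1 a2 a3)
    (ex_intro _ ord0 (b_neq0 ord0)) (tangent_section_nonconstant char2 char3 b_neq0)
    (fun L iota t => tangent_section_base_point_free char2 char3 b_neq0 iota t).
set F := param b p i1 i2 i3 in dom_F.
have f_F : f \mPo F = 0.
  rewrite comp_diagonal_form.
  under eq_bigr do rewrite tnth_param.
  by apply: third_point_on; [exact: param_base_on | exact: tangent_directionP uniq_i].
exists F; split=> //.
  split=> //; first by exists 24%N => i; exact: param_homog.
  exists ord0; have := generic_coord_neq0 b_neq0 (param_generic (@tofrac_inj _) dom_F) ord0.
  by apply: contraNneq => ->; rewrite rmorph0.
have [k k_le6 deg_k] :=
  param_has_degree_le6 (@tofrac_inj _) char3 b_neq0 p_le4 uniq_i p_on dom_F P2 P4 q0.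
exists k => //; apply: extension_degree_ext deg_k => // u.
(* The two conditions on denominators agree: [f_F] gives one direction and dominance the other. *)
split=> -[d [G [H [G_d H_d H_n ->]]]]; exists d, G, H; split=> //.
  by case=> Q HQ; case/eqP: H_n; rewrite HQ rmorphM /= f_F mulr0.
by apply/eqP => HF; apply: H_n; apply: dom_F H_d HF.
Qed.
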